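(* If a planar knotoid diagram $D$ is invertible, then $H_D(t^{-1},y,z)=H_D(t,y,z)$.
   Context: **Planar knotoid diagrams.** A planar knotoid diagram $D$ is a generic immersion of the oriented interval $[0,1]$ into $\mathbb{R}^2$ with finitely many transverse double points (crossings), each carrying over/under information. It is oriented from $0$ to $1$. The images of $0$ and $1$ are the tail and the head; they are distinct from the double points. The sign $\operatorname{sgn}(c)=\pm1$ of a crossing $c$ is the usual one: $+1$ if the over-strand direction is rotated counterclockwise (by less than $\pi$) to the under-strand direction, and $-1$ otherwise. Two diagrams are equivalent if they are related by a finite sequence of planar isotopies and oriented Reidemeister moves $\Omega_1,\Omega_2,\Omega_3$ performed away from the tail and head; pulling an endpoint over or under an arc is forbidden. Equivalence classes are planar knotoids. **Invertible.** The inverse $-D$ of $D$ is obtained by reversing its orientation. $D$ is invertible if $D$ and $-D$ are equivalent. **Gauss diagram.** $G(D)$ is a counterclockwise oriented arc of a circle (the circle minus a gap between head and tail), running from the tail to the head, with a chord joining the two preimages of each crossing. Each chord $c$ is directed from the overcrossing to the undercrossing and carries the sign $\operatorname{sgn}(c)$ of its crossing. $C(G(D))$ is the set of chords. For a chord $c$, let $r(c)$ (resp. $\ell(c)$) be the set of chords $e\ne c$ intersecting $c$ and passing through $c$ from left to right (resp. from right to left) with respect to the direction of $c$, where $e$ is traversed in its own direction. Thus $e\in r(c)$ means that the starting point of $e$ is on the left of $c$ and its end point on the right. Let $r^{\pm}(c)$ and $\ell^{\pm}(c)$ be the subsets of chords of sign $\pm$. **Degree.** $d(c)=|r^+(c)|-|r^-(c)|-|\ell^+(c)|+|\ell^-(c)|$.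 **Index functions.** For a chord $c$ put $R_{|d(c)|}=\mathbb{Z}[z^{\pm1}]/(z^{|d(c)|}-1)$ (so $R_0=\mathbb{Z}[z^{\pm1}]$ and $R_1=\mathbb{Z}$), and $\phi_c(k)=k \bmod |d(c)|$, with $\phi_c=\mathrm{id}$ if $d(c)=0$. For $n\in\mathbb{N}=\{0,1,2,\dots\}$ let $r^n(c)=\{e\in r(c):\gcd(d(c),d(e))=n\}$ and $\ell^n(c)=\{e\in\ell(c):\gcd(d(c),d(e))=n\}$, where $\gcd(a,0)=|a|$ and $\gcd(0,0)=0$. The $n$-th index function is $$\operatorname{Ind}_c^n(z)=\sum_{e\in r^n(c)}\operatorname{sgn}(e)\,z^{\phi_c(d(e))}-\sum_{e\in\ell^n(c)}\operatorname{sgn}(e)\,z^{\phi_c(-d(e))}\in R_{|d(c)|}.$$ **The function $H_D$.** $$H_D(t,y,z)=\sum_{c\in C(G(D)),\,n\in\mathbb{N}}\operatorname{sgn}(c)\left(t^{\operatorname{Ind}_c^n(z)}-1\right)y^n,$$ a finite sum since $\operatorname{Ind}_c^n(z)\neq0$ for only finitely many pairs $(c,n)$. Here $t^f$ (for $f\in R_k$, $k\ge0$) is a formal symbol, with $t^0=1$ for the zero of every $R_k$. So $H_D$ is a polynomial in $y$ with coefficients in the free abelian group on the symbols $t^f$, where $f$ runs over the disjoint union of the $R_k$ ($k\geq 0$) with all zero elements identified. Substituting $t^{-1}$ for $t$ means replacing $t^{f}$ by $t^{-f}$. *)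

(* Defs.v *)
From HB Require Import structures.
From mathcomp Require Import all_boot all_order all_algebra finmap.
From mathcomp Require Import all_classical all_reals all_analysis.
From mathcomp.multinomials Require Import freeg.
From Stdlib Require Import Relations.

Set Implicit Arguments.
Unset Strict Implicit.
Unset Printing Implicit Defensive.

Import Order.TTheory GRing.Theory Num.Theory.
Import numFieldNormedType.Exports.

Local Open Scope classical_set_scope.
Local Open Scope ring_scope.

Notation plane R := (R * R)%type (only parsing).

Definition cross (R : realType) (v w : R * R) : R := v.1 * w.2 - v.2 * w.1.

Definition double_point (R : realType) (f : R -> R * R) (s t : R) : Prop :=
  [/\ 0 <= s <= 1, 0 <= t <= 1, s != t & f s = f t].

(* A generic immersion of [0,1] in the plane, of class C^1, with crossing
   information.  The curve is given by a C^1 function on the whole line, of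
   which only the restriction to [0,1] matters: every clause below that does
   not express regularity, and every relation between diagrams, looks at
   parameters in [0,1] only.  [over] is the set of the parameters at which the
   curve passes over itself; [over_double] makes it contain no other
   parameter. *)
Record diagram (R : realType) := Diagram {
  curve :> R -> R * R;
  over : set R;
  curve_derivable : forall t, derivable curve t 1;
  curve_C1 : continuous (curve^`())%classic;
  curve_immersion : forall t, 0 <= t <= 1 -> (curve^`())%classic t != 0;
  double_finite : finite_set [set st : R * R | double_point curve st.1 st.2];
  double_transverse : forall s t, double_point curve s t ->
    cross ((curve^`())%classic s) ((curve^`())%classic t) != 0;
  no_triple : forall s t u,
    double_point curve s t -> double_point curve t u -> s = u;
  ends_simple : forall s t, double_point curve s t -> 0 < s < 1;
  over_double : forall s, over s -> exists t, double_point curve s t;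
  over_under : forall s t, double_point curve s t -> (over s <-> ~ over t)
}.

Section Inverse.
Variable R : realType.
Implicit Types D : diagram R.

Definition rev_curve (f : R -> R * R) : R -> R * R := fun t => f (1 - t).

Lemma rev_curve_derive (f : R -> R * R) (t : R) : (forall s, derivable f s 1) ->
  is_derive t (1 : R) (rev_curve f) (- (f^`())%classic (1 - t)).
Proof.
move=> df.
have h : is_derive t (1:R) (fun t : R => 1 - t) (-1 : R).
  by have := @is_deriveB R R R (cst 1) id t 1 0 1 _ _; rewrite sub0r; apply.
have dg : differentiable (fun t : R => 1 - t) t.
  by apply/derivable1_diffP; case: h.
have dF : differentiable f (1 - t) by apply/derivable1_diffP.
have dc : differentiable (rev_curve f) t by apply: (differentiable_comp dg dF).
apply: DeriveDef; first exact/derivable1_diffP.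
rewrite deriveE // /rev_curve (diff_comp dg dF) /=.
have <- : 'D_1 (fun t : R => 1 - t) t = 'd (fun t : R => 1 - t) t 1.
  by rewrite deriveE.
have -> : 'D_1 (fun t : R => 1 - t) t = -1 by case: h.
by rewrite derive1E deriveE // raddfN.
Qed.

Lemma rev_curve_derive1 (f : R -> R * R) (t : R) : (forall s, derivable f s 1) ->
  ((rev_curve f)^`())%classic t = - (f^`())%classic (1 - t).
Proof. by move=> df; rewrite derive1E; case: (rev_curve_derive t df). Qed.

Lemma rev01 (t : R) : 0 <= t <= 1 -> 0 <= 1 - t <= 1.
Proof. by move=> /andP[a b]; rewrite subr_ge0 b lerBlDr lerDl. Qed.

Lemma rev_double (f : R -> R * R) (s t : R) :
  double_point (rev_curve f) s t -> double_point f (1 - s) (1 - t).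
Proof.
case=> hs ht st e; split; rewrite ?rev01 //.
by apply: contra st => /eqP /addrI /oppr_inj ->.
Qed.

Lemma rev_double' (f : R -> R * R) (s t : R) :
  double_point f (1 - s) t -> double_point (rev_curve f) s (1 - t).
Proof.
case=> hs ht st e; split; rewrite ?rev01 //.
- by have := rev01 hs; rewrite subKr.
- by apply: contra st => /eqP ->; rewrite subKr.
- by rewrite /rev_curve e subKr.
Qed.

Program Definition inverse D : diagram R :=
  @Diagram R (rev_curve D) [set t | over D (1 - t)] _ _ _ _ _ _ _ _ _.
Next Obligation.
by move=> D t; case: (rev_curve_derive t (@curve_derivable _ D)).
Qed.
Next Obligation.
move=> D.
have -> : ((rev_curve D)^`())%classic = (fun t => - (D^`())%classic (1 - t)).
  by apply/funext => t; apply/rev_curve_derive1/curve_derivable.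
move=> t; apply: (@cvgN R).
apply: (@continuous_comp _ _ _ (fun t : R => 1 - t)); last exact: curve_C1.
by apply: (@cvgB R); [exact: cvg_cst | exact: cvg_id].
Qed.
Next Obligation.
move=> D t ht; rewrite rev_curve_derive1 ?oppr_eq0; last exact: curve_derivable.
exact/curve_immersion/rev01.
Qed.
Next Obligation.
move=> D; apply: sub_finite_set
  (finite_image (fun st : R * R => (1 - st.1, 1 - st.2)) (@double_finite _ D)).
move=> [s t] /rev_double h; exists (1 - s, 1 - t) => //=.
by rewrite !subKr.
Qed.
Next Obligation.
move=> D s t /rev_double /double_transverse.
rewrite !rev_curve_derive1; [|exact: curve_derivable..].
by rewrite /cross /= !mulrNN.
Qed.
Next Obligation.
move=> D s t u /rev_double h /rev_double h'.
by apply/oppr_inj/(@addrI _ 1); apply: no_triple h h'.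
Qed.
Next Obligation.
by move=> D s t /rev_double /ends_simple; rewrite subr_gt0 ltrBlDr ltrDl andbC.
Qed.
Next Obligation.
by move=> D s /= /over_double [t /rev_double' h]; exists (1 - t).
Qed.
Next Obligation.
by move=> D s t /rev_double /over_under.
Qed.

End Inverse.

Section Equivalence.
Variable R : realType.
Implicit Types (D : diagram R) (h : plane R -> plane R).

Definition tangent h (p v : plane R) : plane R := 'd h p v.

Definition C1_map h : Prop :=
  (forall p, differentiable h p) /\
  (forall v : plane R, continuous (fun p : plane R => tangent h p v)).

Definition diffeomorphism h : Prop :=
  C1_map h /\ exists g, [/\ C1_map g, cancel h g & cancel g h].

Definition orientation_preserving h : Prop :=
  forall p, 0 < cross (tangent h p (1, 0)) (tangent h p (0, 1)).

Definition ambient_isotopy (F : R -> plane R -> plane R) : Prop :=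
  let dom := [set q : R * plane R | 0 <= q.1 <= 1] in
  [/\ forall p, F 0 p = p,
      forall a, 0 <= a <= 1 -> diffeomorphism (F a),
      {within dom, continuous (fun q : R * plane R => F q.1 q.2)} &
      forall v : plane R,
        {within dom, continuous (fun q : R * plane R => tangent (F q.1) q.2 v)}].

Definition reparametrization (f : R -> R) : Prop :=
  [/\ f 0 = 0, f 1 = 1, forall t, derivable f t 1,
      continuous (f^`())%classic &
      forall t, 0 <= t <= 1 -> 0 < (f^`())%classic t].

Definition planar_isotopic D D' : Prop :=
  exists F f, [/\ ambient_isotopy F, reparametrization f &
    forall t, 0 <= t <= 1 ->
      D' t = F 1 (D (f t)) /\ (over D' t <-> over D (f t))].

(* [local_move m m' D D']: up to an orientation-preserving diffeomorphism [h]
   of the plane, D and D' differ only in the box [-2,2] x [-2,2], which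
   contains no endpoint of D or D'; there D consists of the strands
   [m i : [-2,2] -> box] and D' of the strands [m' i].  Strand [i] is run
   through at the parameters [p i + r i * u], so the sign of [r i] is its
   orientation relative to the model, and [lev] gives the heights of the
   strands.  A crossing of a strand with itself may be of either kind. *)
Definition local_move n (m m' : n.-tuple (R -> plane R)) D D' : Prop :=
  exists h (p r : 'I_n -> R) (lev : 'I_n -> nat),
  let at_ i u := p i + r i * u in
  let model_box := [set q : plane R | `|q.1| <= 2 /\ `|q.2| <= 2] in
  let over_levels (E : diagram R) (k : n.-tuple (R -> plane R)) :=
    forall i j u v, i != j -> `|u| <= 2 -> `|v| <= 2 ->
      tnth k i u = tnth k j v -> (over E (at_ i u) <-> (lev j < lev i)%N) in
  [/\ diffeomorphism h, orientation_preserving h,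
      (forall i, r i != 0) /\ injective lev &
      [/\ forall i u, `|u| <= 2 -> 0 < at_ i u < 1,
          forall i j u v, i != j -> `|u| <= 2 -> `|v| <= 2 ->
            at_ i u != at_ j v,
          forall i u, `|u| <= 2 ->
            D (at_ i u) = h (tnth m i u) /\ D' (at_ i u) = h (tnth m' i u),
          over_levels D m /\ over_levels D' m' &
          forall s, 0 <= s <= 1 ->
            (forall i u, `|u| <= 2 -> s != at_ i u) ->
            [/\ D' s = D s, over D' s <-> over D s & ~ (h @` model_box) (D s)]]].

(* A C^1 bump on [-2,2]: it vanishes to first order at -2 and 2, so that the
   two sides of each move below agree to first order at the ends of the
   strands; it is 1 exactly at -1 and 1, and bump 0 = 16/9. *)
Definition bump (u : R) : R := (4 - u ^+ 2) ^+ 2 / 9.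

(* The right-hand strand has one double point, at u = -1 and u = 1.  The sign
   of [r] and the choice of the overcrossing give the four oriented versions. *)
Definition Omega1 : diagram R -> diagram R -> Prop :=
  local_move [tuple fun u => (u, 0)]
             [tuple fun u => (u * (1 - bump u), bump u)].

(* On the right-hand side the strands meet twice, at u = -1 and u = 1. *)
Definition Omega2 : diagram R -> diagram R -> Prop :=
  local_move [tuple fun u => (u, 0); fun u => (u, 1)]
             [tuple fun u => (u, 0); fun u => (u, 1 - bump u)].

(* The third strand passes above, then below, the crossing of the diagonals. *)
Definition Omega3 : diagram R -> diagram R -> Prop :=
  local_move [tuple fun u => (u, u); fun u => (u, - u); fun u => (u, bump u)]
             [tuple fun u => (u, u); fun u => (u, - u); fun u => (u, - bump u)].

Definition elementary_move D D' : Prop :=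
  [\/ planar_isotopic D D', Omega1 D D', Omega2 D D' | Omega3 D D'].

Definition equivalent : diagram R -> diagram R -> Prop :=
  clos_refl_sym_trans (diagram R) elementary_move.

Definition invertible D : Prop := equivalent D (inverse D).

End Equivalence.

(* The arc of the circle is parametrized by [0,1] from the tail to the head; a
   chord (o, u) goes from the preimage o of the overcrossing to the preimage u
   of the undercrossing. *)
Record gauss_diagram (R : realType) := GaussDiagram {
  chords : {fset R * R};
  csign : R * R -> int
}.

Definition gauss (R : realType) (D : diagram R) : gauss_diagram R :=
  GaussDiagram
    (fset_set [set c : R * R | double_point D c.1 c.2 /\ over D c.1])
    (fun c => sgz (cross ((D^`())%classic c.1) ((D^`())%classic c.2))).

Section Index.
Variables (R : realType) (G : gauss_diagram R).
Implicit Types (c e : R * R) (a b x : R) (n : nat).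

(* x lies on the open counterclockwise arc from a to b of the circle, which
   crosses the gap between head and tail if b < a. *)
Definition ccw_between a b x : bool :=
  if a < b then a < x < b else (a < x) || (x < b).

(* The chord from a point P to a point Q of a circle has the counterclockwise
   arc from P to Q on its right and the one from Q to P on its left. *)
Definition right_of c x : bool := ccw_between c.1 c.2 x.
Definition left_of c x : bool := ccw_between c.2 c.1 x.

Definition rset c : {fset R * R} :=
  [fset e in chords G | [&& e != c, left_of c e.1 & right_of c e.2]]%fset.
Definition lset c : {fset R * R} :=
  [fset e in chords G | [&& e != c, right_of c e.1 & left_of c e.2]]%fset.

Definition of_sign (s : int) (A : {fset R * R}) : {fset R * R} :=
  [fset e in A | csign G e == s]%fset.

Definition degree c : int :=
  #|` of_sign 1 (rset c)|%:Z - #|` of_sign (-1) (rset c)|%:Z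
  - #|` of_sign 1 (lset c)|%:Z + #|` of_sign (-1) (lset c)|%:Z.

Definition of_gcd n c (A : {fset R * R}) : {fset R * R} :=
  [fset e in A | gcdz (degree c) (degree e) == n%:Z]%fset.

(* Z[z, z^-1] is the free abelian group on the exponents of z, and R_k, for k
   in nat, is the free abelian group on the powers z^i with i a residue modulo
   k: an element of R_k is represented by the Laurent polynomial whose
   exponents i satisfy (i %% k)%Z = i, that is 0 <= i < k if k > 0 and i
   arbitrary if k = 0 (recall that (i %% 0)%Z = i). *)
Definition laurent := {freeg int / int}.

(* As (i %% k)%Z = (i %% `|k|)%Z, this covers all values of the degree. *)
Definition phi c (i : int) : int := (i %% degree c)%Z.

Definition Ind n c : laurent :=
  \sum_(e <- of_gcd n c (rset c)) << csign G e *g phi c (degree e) >>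
  - \sum_(e <- of_gcd n c (lset c)) << csign G e *g phi c (- degree e) >>.

(* The exponent of a symbol t^f, f in R_k, is the pair (k, f), except that the
   zeros of all the R_k are represented by (0, 0).  The symbol itself is the
   corresponding generator of a free abelian group. *)
Definition exponent := (nat * laurent)%type.
Definition texp (k : nat) (f : laurent) : {freeg exponent / int} :=
  << if f == 0 then (0%N, 0) else (k, f) >>.
(* The symbol t^0. *)
Definition tone : {freeg exponent / int} := << (0%N, 0) >>.

(* A polynomial in y is given by its sequence of coefficients. *)
Definition H_gauss (n : nat) : {freeg exponent / int} :=
  \sum_(c <- chords G)
    csign G c *: (texp `|degree c|%N (Ind n c) - tone).

End Index.

Definition H (R : realType) (D : diagram R) : nat -> {freeg exponent / int} :=
  H_gauss (gauss D).

(* The coefficients do form a polynomial. *)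
Lemma H_finite (R : realType) (D : diagram R) :
  exists N, forall n, (N <= n)%N -> H D n = 0.
Proof.
pose G := gauss D.
pose N := \sum_(c <- chords G) \sum_(e <- chords G)
            (absz (gcdz (degree G c) (degree G e))).+1.
exists N => n Nn; rewrite /H /H_gauss -/G.
rewrite big_seq big1 // => c cG.
have E (A : {fset R * R}) :
    (A `<=` chords G)%fset -> of_gcd G n c A = fset0.
  move=> /fsubsetP AG; apply/fsetP => e; rewrite !inE /=.
  apply/negP => /andP[/AG eG /eqP ge].
  suff : (n < N)%N by rewrite ltnNge Nn.
  have -> : n = absz (gcdz (degree G c) (degree G e)) by rewrite ge.
  rewrite /N (big_rem c) // [X in (_ < X + _)%N](big_rem e) //.
  by rewrite -addnA addSn ltnS leq_addr.
rewrite /Ind !E.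
- by rewrite !big_seq_fset0 subrr /texp eqxx subrr scaler0.
- by apply/fsubsetP => e; rewrite !inE => /andP[].
- by apply/fsubsetP => e; rewrite !inE => /andP[].
Qed.

(* The substitution of t^-1 for t in a polynomial in y. *)
Definition subst_tinv (P : nat -> {freeg exponent / int}) :
    nat -> {freeg exponent / int} :=
  fun n => fglift (fun x : exponent => << (x.1, - x.2) >>) (P n).

Lemma fglift_texp k f :
  fglift (fun x : exponent => (<< (x.1, - x.2) >> : {freeg exponent / int}))
    (texp k f) = texp k (- f).
Proof.
rewrite /texp liftU scale1r oppr_eq0.
by case: eqP => //=; rewrite oppr0.
Qed.

(* Main.v *)
(** Write I(c,e) = 1, -1 or 0 according as e lies in r(c), in l(c) or in
    neither. Then d(c) is the sum of the sgn(e) I(c,e), and e contributes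
    the monomial sgn(e) I(c,e) z^(I(c,e) d(e)) to the index functions of c;
    so H depends only on the signs and on the matrix I. Reversing the
    orientation keeps the signs and negates I, hence negates all degrees and
    index functions: this substitutes t^-1 for t in H. It remains to see
    that H is invariant under equivalence. Planar isotopies preserve the
    signs, since their Jacobians are positive by connectedness of [0,1]. The
    new chord of the first move is isolated, and the two new chords of the
    second one have the same row and column of I and opposite signs, so they
    cancel. In the third move, exactly the three pairs of chords of the
    triangle change from disjoint to intersecting or conversely. The degrees
    do not change, and with suitable signs the degrees of the three chords
    add up to 0, because their loops add up to the boundary of the triangle.
    Hence, modulo the degree of one of these chords, the degrees of the
    other two agree up to sign, and so do their contributions to its index
    functions before and after the move. *)
Require Import Defs.
From HB Require Import structures.
From mathcomp Require Import all_boot all_order all_algebra finmap.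
From mathcomp Require Import all_classical all_reals all_analysis.
From mathcomp.multinomials Require Import freeg.
From mathcomp Require Import ring lra zify.

Set Implicit Arguments.
Unset Strict Implicit.
Unset Printing Implicit Defensive.

Import Order.TTheory GRing.Theory Num.Theory.
Import numFieldNormedType.Exports Defs.
Local Open Scope classical_set_scope.
Local Open Scope ring_scope.

(** * Weighted intersection matrices *)

Section Weighted.
Variable T : eqType.
Implicit Types (s : seq T) (sg d : T -> int) (I J : T -> T -> int) (n : nat).

Definition wdeg s sg I c : int := \sum_(e <- s) sg e * I c e.

(** The degrees enter as an argument [d], so that the terms of two matrices can be compared under
    one degree function, wherever it comes from. *)
Definition wterm sg I d n c e : laurent :=
  if gcdz (d c) (d e) == n%:Z then << sg e * I c e *g (I c e * d e %% d c)%Z >>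
  else 0.

Definition wind s sg I n c : laurent :=
  \sum_(e <- s) wterm sg I (wdeg s sg I) n c e.

Definition wH s sg I n : {freeg exponent / int} :=
  \sum_(c <- s) sg c *: (texp `|wdeg s sg I c|%N (wind s sg I n c) - tone).

Lemma wH_eq s s' sg sg' I J n : perm_eq s s' ->
  {in s, sg =1 sg'} -> {in s &, I =2 J} -> wH s sg I n = wH s' sg' J n.
Proof.
move=> ss' Esg EI.
have Ed c : c \in s -> wdeg s sg I c = wdeg s' sg' J c.
  move=> cs; rewrite /wdeg -(perm_big s' ss') /=; apply: eq_big_seq => e es.
  by rewrite Esg // EI.
rewrite /wH -(perm_big s' ss') /=; apply: eq_big_seq => c cs.
rewrite Esg // Ed //; congr (_ *: (texp _ _ - _)).
rewrite /wind -(perm_big s' ss') /=; apply: eq_big_seq => e es.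
by rewrite /wterm !Ed // Esg // EI.
Qed.

(** Negating the matrix negates every degree, which changes neither the gcds nor the moduli. The
    exponents I(c,e) d(e) are products of two negated factors and stay the same, so only the
    coefficients change sign. *)
Lemma wH_opp s sg I n :
  wH s sg (fun c e => - I c e) n =
  \sum_(c <- s) sg c *: (texp `|wdeg s sg I c|%N (- wind s sg I n c) - tone).
Proof.
have Ed c : wdeg s sg (fun c e => - I c e) c = - wdeg s sg I c.
  by rewrite /wdeg -sumrN; apply: eq_bigr => e _; rewrite mulrN.
apply: eq_bigr => c _; rewrite Ed abszN; congr (_ *: (texp _ _ - _)).
rewrite /wind -sumrN; apply: eq_bigr => e _.
rewrite /wterm !Ed gcdzN gcdNz.
case: ifP => _; last by rewrite oppr0.
by rewrite mulrN modzN mulrNN freegUN.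
Qed.

(** A zero row gives c the index 0, hence the term t^0 - 1 = 0. A zero column removes c from the
    degrees and index functions of the other chords. *)
Lemma wH_isolated s sg I n c :
    (forall e, e \in c :: s -> I c e = 0 /\ I e c = 0) ->
  wH (c :: s) sg I n = wH s sg I n.
Proof.
move=> Ic.
have Ed e : e \in c :: s -> wdeg (c :: s) sg I e = wdeg s sg I e.
  by move=> /Ic [_ h]; rewrite /wdeg big_cons h mulr0 add0r.
have Et e : e \in c :: s -> wind (c :: s) sg I n e = wind s sg I n e.
  move=> he; rewrite /wind big_cons {1}/wterm (Ic _ he).2 mulr0 freegU0 if_same.
  rewrite add0r; apply: eq_big_seq => f fs.
  by rewrite /wterm !Ed // in_cons fs orbT.
have dc : wind s sg I n c = 0.
  rewrite /wind big_seq big1 // => e es.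
  by rewrite /wterm (Ic e _).1 ?in_cons ?es ?orbT // mulr0 freegU0 if_same.
rewrite /wH big_cons Et ?mem_head // dc /texp eqxx subrr scaler0 add0r.
apply: eq_big_seq => e es.
by rewrite Ed ?Et // in_cons es orbT.
Qed.

(** Equal columns and opposite signs make c and c' cancel in the degree and index functions of every
    other chord. Their own degrees and index functions agree because
    [sg c * I c' c = sg c' * I c c'], so their terms in H cancel too. *)
Lemma wH_parallel s sg I n c c' :
    sg c' = - sg c -> I c c = 0 -> I c' c' = 0 -> I c' c = - I c c' ->
    (forall e, e \in s -> I c e = I c' e /\ I e c = I e c') ->
  wH [:: c, c' & s] sg I n = wH s sg I n.
Proof.
move=> sc Icc Icc' Iac Ip; set s' := [:: c, c' & s].
have Ed e : e \in s -> wdeg s' sg I e = wdeg s sg I e.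
  by move=> /Ip [_ h]; rewrite /wdeg !big_cons h sc mulNr addrA subrr add0r.
have Edc : wdeg s' sg I c' = wdeg s' sg I c.
  rewrite /wdeg !big_cons Icc Icc' Iac sc !mulr0 !add0r mulNr mulrN;
    congr (_ + _).
  by apply: eq_big_seq => e /Ip [->].
have Et e : e \in s -> wind s' sg I n e = wind s sg I n e.
  move=> es; rewrite /wind !big_cons {1 2}/wterm -(Ip _ es).2 Edc sc addrA.
  set u := (X in X + _); have -> : u = 0.
    by rewrite /u; case: ifP; rewrite ?addr0 // freegUD mulNr subrr freegU0.
  by rewrite add0r; apply: eq_big_seq => f fs; rewrite /wterm !Ed.
have Etc : wind s' sg I n c' = wind s' sg I n c.
  have t0 x : I x x = 0 -> wterm sg I (wdeg s' sg I) n x x = 0.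
    by move=> h; rewrite /wterm h mulr0 freegU0 if_same.
  rewrite /wind !big_cons !t0 // !add0r; congr (_ + _).
    by rewrite /wterm Edc Iac sc !modzMl mulrN mulNr.
  by apply: eq_big_seq => e /Ip [ce _]; rewrite /wterm Edc ce.
rewrite /wH !big_cons Edc Etc sc addrA scaleNr subrr add0r.
by apply: eq_big_seq => e es; rewrite Ed ?Et.
Qed.

Lemma modz_eqmod (a b m : int) : (m %| a - b)%Z -> (a %% m)%Z = (b %% m)%Z.
Proof. by move=> h; apply/eqP; rewrite eqz_mod_dvd. Qed.

Definition is1 (b : int) : int := (b == 1)%:Z.

(** Puts all values of i on the common pair of monomials z^k and z^-k: up to the factor a, the term
    is z^k for i = 1, -z^-k for i = -1 and 0 for i = 0. *)
Lemma freeg_sign (a k m x : int) (i : int) : i \in [:: -1; 0; 1] ->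
  (m %| x - i * k)%Z ->
  << a * i *g (x %% m)%Z >> =
  << a * is1 i *g (k %% m)%Z >> - << a * is1 (- i) *g (- k %% m)%Z >> :>
    laurent.
Proof.
move=> hi /modz_eqmod ->; move: hi.
rewrite !inE => /or3P[] /eqP ->; rewrite /is1 /=.
- by rewrite mulN1r mulr0 freegU0 sub0r freegUN mulr1 mulrN1.
- by rewrite !mulr0 !freegU0 subrr.
- by rewrite mul1r !mulr1 mulr0 freegU0 subr0.
Qed.

(* By the linear relation, the degrees of [e] and [f] are the same up to sign
   modulo that of [c], so both terms are multiples of z^k and z^-k for one k.
   The last two hypotheses say that the sum and the difference of the
   coefficients of z^k and z^-k agree. *)
Lemma wterm_pair sg I J d n c e f (w : T -> int) :
    (forall x, w x \in [:: -1; 1]) ->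
    w c * d c + w e * d e + w f * d f = 0 ->
    [/\ I c e \in [:: -1; 0; 1], I c f \in [:: -1; 0; 1],
        J c e \in [:: -1; 0; 1] & J c f \in [:: -1; 0; 1]] ->
    sg e * I c e + sg f * I c f = sg e * J c e + sg f * J c f ->
    sg e * w e * I c e ^+ 2 - sg f * w f * I c f ^+ 2 =
    sg e * w e * J c e ^+ 2 - sg f * w f * J c f ^+ 2 ->
  wterm sg I d n c e + wterm sg I d n c f =
  wterm sg J d n c e + wterm sg J d n c f.
Proof.
move=> hw dcyc [Ie If Je Jf] sumE sqE.
have w2 x : w x * w x = 1 by move: (hw x); rewrite !inE => /orP[] /eqP ->.
have w2' x y : w x * (w x * y) = y by rewrite mulrA w2 mul1r.
have dvdE x y : x = y -> (d c %| x - y)%Z by move=> ->; rewrite subrr dvdz0.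
have mem3 i x : i \in [:: -1; 0; 1] -> w x * i \in [:: -1; 0; 1].
  by move: (hw x); rewrite !inE => /orP[] /eqP -> /or3P[] /eqP ->.
have mem3N i x : i \in [:: -1; 0; 1] -> - (w x * i) \in [:: -1; 0; 1].
  by move: (hw x); rewrite !inE => /orP[] /eqP -> /or3P[] /eqP ->.
have df : d f = - w f * w c * d c - w f * (w e * d e).
  rewrite -[LHS](w2' f) -[X in _ * X](addrK (w c * d c + w e * d e)).
  by rewrite addrC in dcyc; rewrite dcyc sub0r; ring.
have gE : gcdz (d c) (d f) = gcdz (d c) (d e).
  rewrite df gcdzMDl -mulNr mulrA.
  move: (hw f) (hw e); rewrite !inE => /orP[] /eqP -> /orP[] /eqP ->;
  by rewrite ?(mulrN1, opprK, mul1r, mulN1r, gcdzN).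
rewrite /wterm gE; case: eqP => _; last by rewrite !addr0.
pose k := w e * d e.
have TE K : K c e \in [:: -1; 0; 1] -> K c f \in [:: -1; 0; 1] ->
  << sg e * K c e *g (K c e * d e %% d c)%Z >> +
  << sg f * K c f *g (K c f * d f %% d c)%Z >> =
  << sg e * w e * is1 (w e * K c e) - sg f * w f * is1 (- (w f * K c f))
     *g (k %% d c)%Z >> -
  << sg e * w e * is1 (- (w e * K c e)) - sg f * w f * is1 (w f * K c f)
     *g (- k %% d c)%Z >> :> laurent.
  move=> Ke Kf.
  have -> : sg e * K c e = sg e * w e * (w e * K c e).
    by rewrite -mulrA w2'.
  (* The relation makes [w f * d f] congruent to -k modulo [d c], so f enters with the opposite of
     [w f * K c f]. *)
  have -> : sg f * K c f = - (sg f * w f) * - (w f * K c f).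
    by rewrite mulrNN -mulrA w2'.
  rewrite (@freeg_sign (sg e * w e) k) ?mem3 //; last first.
    by apply: dvdE; rewrite /k mulrACA w2 mul1r.
  rewrite (@freeg_sign (- (sg f * w f)) k) ?mem3N //; last first.
    apply/dvdzP; exists (- (K c f * w f * w c)); rewrite df /k; ring.
  rewrite !mulNr -!freegUN -!freegUB !opprK opprB addrACA.
  by congr (_ + _); rewrite addrC.
rewrite !TE //.
have is1E i : i \in [:: -1; 0; 1] ->
  is1 i - is1 (- i) = i /\ is1 i + is1 (- i) = i ^+ 2.
  by rewrite !inE => /or3P[] /eqP ->.
have Q i x : i \in [:: -1; 0; 1] ->
  w x * (is1 (w x * i) - is1 (- (w x * i))) = i /\
  is1 (w x * i) + is1 (- (w x * i)) = i ^+ 2.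
  move=> hi; have [-> ->] := is1E _ (mem3 _ x hi).
  by rewrite w2' exprMn expr2 w2 mul1r.
have [a1 a2] := Q _ e Ie; have [b1 b2] := Q _ f If.
have [c1 c2] := Q _ e Je; have [d1 d2] := Q _ f Jf.
have [-> ->] // :
   sg e * w e * is1 (w e * I c e) - sg f * w f * is1 (- (w f * I c f)) =
   sg e * w e * is1 (w e * J c e) - sg f * w f * is1 (- (w f * J c f)) /\
   sg e * w e * is1 (- (w e * I c e)) - sg f * w f * is1 (w f * I c f) =
   sg e * w e * is1 (- (w e * J c e)) - sg f * w f * is1 (w f * J c f).
  rewrite -a2 -b2 -c2 -d2 in sqE; rewrite -{1}a1 -{1}b1 -{1}c1 -{1}d1 in sumE.
  move: sqE sumE; clear.
  do ?move: (is1 _).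
  by move: (sg e) (sg f) (w e) (w f) => *; nia.
Qed.

(** Entries involving a chord of [s] are unchanged, so only the sums inside [tri] have to be
    compared. The linear relation among the degrees of [tri] holds for the part coming from each
    chord of [s] and for the part coming from [tri], hence for the full degrees. Since these depend
    on [s], the last hypothesis is stated for every [d] with this relation. *)
Lemma wH_triangle tri s sg I J (w : T -> int) n :
    {in s & tri, forall e c, I c e = J c e /\ I e c = J e c} ->
    {in s &, I =2 J} ->
    {in tri, wdeg tri sg I =1 wdeg tri sg J} ->
    {in s, forall e, \sum_(c <- tri) w c * I c e = 0} ->
    \sum_(c <- tri) w c * wdeg tri sg I c = 0 ->
    (forall d, \sum_(c <- tri) w c * d c = 0 -> forall c, c \in tri ->
      \sum_(e <- tri) wterm sg I d n c e =
      \sum_(e <- tri) wterm sg J d n c e) ->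
  wH (tri ++ s) sg I n = wH (tri ++ s) sg J n.
Proof.
move=> IJts IJs dtri wI wd tE.
have Ed : {in tri ++ s, wdeg (tri ++ s) sg I =1 wdeg (tri ++ s) sg J}.
  move=> c; rewrite mem_cat /wdeg !big_cat /= => /orP[ct|cs].
    have := dtri c ct; rewrite /wdeg => ->; congr (_ + _).
    by apply: eq_big_seq => e es; rewrite (IJts e c es ct).1.
  congr (_ + _); apply: eq_big_seq => e et; last by rewrite IJs.
  by rewrite (IJts c e cs et).2.
have wd' : \sum_(c <- tri) w c * wdeg (tri ++ s) sg I c = 0.
  rewrite /wdeg; under eq_bigr do rewrite big_cat /= mulrDr.
  rewrite big_split /= wd add0r; under eq_bigr do rewrite mulr_sumr.
  rewrite exchange_big big_seq big1 //= => e es.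
  under eq_bigr do rewrite mulrCA.
  by rewrite -mulr_sumr wI // mulr0.
apply: eq_big_seq => c cts; rewrite Ed //; congr (_ *: (texp _ _ - _)).
have -> : wind (tri ++ s) sg J n c =
  \sum_(e <- tri ++ s) wterm sg J (wdeg (tri ++ s) sg I) n c e.
  by apply: eq_big_seq => e es; rewrite /wterm !Ed.
rewrite /wind !big_cat /=.
move: cts; rewrite mem_cat => /orP[ct|cs].
  rewrite tE //; congr (_ + _).
  by apply: eq_big_seq => e es; rewrite /wterm (IJts e c es ct).1.
congr (_ + _); apply: eq_big_seq => e et; last by rewrite /wterm IJs.
by rewrite /wterm (IJts c e cs et).2.
Qed.

End Weighted.

Lemma wH_map (T U : eqType) (f : T -> U) (s : seq T) sg I n :
  wH [seq f x | x <- s] sg I n =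
  wH s (sg \o f) (fun x y => I (f x) (f y)) n.
Proof.
have Ed x : wdeg [seq f x | x <- s] sg I (f x) =
            wdeg s (sg \o f) (fun x y => I (f x) (f y)) x.
  by rewrite /wdeg big_map.
rewrite /wH big_map; apply: eq_bigr => x _; rewrite Ed.
by rewrite /wind big_map; under eq_bigr do rewrite /wterm !Ed.
Qed.

(** * Gauss diagrams *)

Section Interlacing.
Variable (P : eqType).
Implicit Types (lt : rel P) (c e : P * P) (x : P).

(** For the order of the parameters, this is [right_of c x] up to a constant depending on c. Being
    the difference of a term in c.2 and the same term in c.1, it telescopes around a triangle of
    chords. *)
Definition side lt c x : int := (lt x c.2)%:Z - (lt x c.1)%:Z.

(* For [lt] the order of the parameters, this is the I(c,e) of the header. *)
Definition inter lt c e : int :=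
  if e == c then 0 else side lt c e.2 - side lt c e.1.

End Interlacing.

Section GaussDiagrams.
Variable R : realType.
Implicit Types (G : gauss_diagram R) (c e : R * R).

Definition simple_gauss G : Prop :=
  [/\ {in chords G, forall c, c.1 != c.2},
      {in chords G &, forall c e, [/\ (c.1 == e.1) = (c == e),
                                  (c.2 == e.2) = (c == e) & c.1 != e.2]} &
      {in chords G, forall c, csign G c \in [:: -1; 1]}].

Lemma side_right c (x : R) : c.1 != c.2 -> x != c.1 -> x != c.2 ->
  side <%R c x = (right_of c x)%:Z - (c.2 < c.1)%R%:Z.
Proof.
rewrite /side /right_of /ccw_between.
case: (ltgtP c.1 c.2); case: (ltgtP x c.1); case: (ltgtP x c.2) => //= *;
  exfalso; lra.
Qed.

Lemma left_rightN c (x : R) : c.1 != c.2 -> x != c.1 -> x != c.2 ->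
  left_of c x = ~~ right_of c x.
Proof.
rewrite /left_of /right_of /ccw_between.
case: (ltgtP c.1 c.2); case: (ltgtP x c.1); case: (ltgtP x c.2) => //= *;
  exfalso; lra.
Qed.

(** The constant in [side_right] cancels, which leaves [right_of c] at the end of e minus
    [right_of c] at its start. *)
Lemma inter_rl c e : e != c -> c.1 != c.2 ->
    e.1 != c.1 -> e.1 != c.2 -> e.2 != c.1 -> e.2 != c.2 ->
  [/\ inter <%R c e \in [:: -1; 0; 1],
      (left_of c e.1 && right_of c e.2) = (inter <%R c e == 1) &
      (right_of c e.1 && left_of c e.2) = (inter <%R c e == -1)].
Proof.
move=> ec c12 e1c1 e1c2 e2c1 e2c2; rewrite /inter (negbTE ec) !side_right //.
rewrite !left_rightN // opprB addrA subrK.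
by case: (right_of c e.1); case: (right_of c e.2).
Qed.

Lemma card_fset_sum (A : {fset R * R}) (Q : pred (R * R)) :
  #|` [fset e in A | Q e]%fset|%:Z = \sum_(e <- A) (Q e)%:Z.
Proof.
rewrite card_fset_sum1 big_fset /= big_mkcond.
rewrite (big_morph Posz PoszD (erefl _)).
by apply: eq_bigr => e _; case: (Q e).
Qed.

Lemma simple_inter G : simple_gauss G -> {in chords G &, forall c e,
  [/\ inter <%R c e \in [:: -1; 0; 1],
      [&& e != c, left_of c e.1 & right_of c e.2] = (inter <%R c e == 1) &
      [&& e != c, right_of c e.1 & left_of c e.2] = (inter <%R c e == -1)]}.
Proof.
move=> [G1 G2 G3] c e cG eG.
have [->|ec] := eqVneq e c; first by rewrite /inter eqxx.
have [a1 a2 a3] := G2 c e cG eG; have [b1 b2 b3] := G2 e c eG cG.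
by apply: inter_rl; rewrite ?G1 ?b1 ?b2 // eq_sym.
Qed.

Lemma degreeE G c : simple_gauss G -> c \in chords G ->
  degree G c = wdeg (chords G) (csign G) (inter <%R) c.
Proof.
move=> GS cG; have [_ _ G3] := GS.
have E s (Q : pred (R * R)) :
    of_sign G s [fset e in chords G | Q e]%fset =
    [fset e in chords G | Q e && (csign G e == s)]%fset.
  by apply/fsetP => e; rewrite !inE andbA.
rewrite /degree /rset /lset !E !card_fset_sum -!sumrB -big_split /=.
apply: eq_big_seq => e eG; have [i3 -> ->] := simple_inter GS cG eG.
by move: i3 (G3 e eG); rewrite !inE => /or3P[] /eqP -> /orP[] /eqP ->.
Qed.

Lemma H_gaussE G n : simple_gauss G ->
  H_gauss G n = wH (chords G) (csign G) (inter <%R) n.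
Proof.
move=> GS; have [_ _ G3] := GS; apply: eq_big_seq => c cG.
rewrite -degreeE //; congr (_ *: (texp _ _ - _)).
have E (Q : pred (R * R)) (F : R * R -> laurent) :
    \sum_(e <- of_gcd G n c [fset e in chords G | Q e]%fset) F e =
    \sum_(e <- chords G) if Q e && (gcdz (degree G c) (degree G e) == n%:Z)
      then F e else 0.
  rewrite /of_gcd big_fset big_mkcond /= big_fset big_mkcond /=.
  by apply: eq_bigr => e _; case: (Q e).
rewrite /Ind /rset /lset !E -sumrB; apply: eq_big_seq => e eG.
have [i3 -> ->] := simple_inter GS cG eG; rewrite /wterm -!degreeE // /phi.
case: (_ == n%:Z); last by rewrite !andbF subrr.
move: i3; rewrite !inE => /or3P[] /eqP -> /=.
- by rewrite sub0r freegUN mulrN1 mulN1r.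
- by rewrite subrr mulr0 freegU0.
- by rewrite subr0 mulr1 mul1r.
Qed.

End GaussDiagrams.

(** * The Gauss diagram of a knotoid diagram and of its inverse *)

Section Chords.
Variable R : realType.
Implicit Types (D E : diagram R) (c e : R * R).

Lemma chordP D c :
  reflect (double_point D c.1 c.2 /\ over D c.1) (c \in chords (gauss D)).
Proof.
rewrite /= in_fset_set; last first.
  by apply: sub_finite_set (@double_finite _ D) => x [].
by apply: (iffP idP); rewrite inE.
Qed.

Lemma double_sym (f : R -> R * R) s t :
  double_point f s t -> double_point f t s.
Proof. by case=> hs ht st e; split=> //; rewrite eq_sym. Qed.

Lemma double_in01 D s t : double_point D s t -> 0 < s < 1 /\ 0 < t < 1.
Proof.
move=> h; split; first exact: ends_simple h.
exact: ends_simple (double_sym h).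
Qed.

Lemma sgz_pm1 (x : R) : x != 0 -> sgz x \in [:: -1; 1].
Proof. by case: sgzP. Qed.

Lemma gauss_simple D : simple_gauss (gauss D).
Proof.
split; first by move=> c /chordP[[_ _ ->]].
  move=> c e /chordP[dc oc] /chordP[de oe].
  have c1 : (c.1 == e.1) = (c == e).
    apply/eqP/eqP => [ce|->//].
    have := no_triple (double_sym dc); rewrite ce => /(_ _ de).
    by move: ce; case: (c) (e) => [? ?] [? ?] /= -> ->.
  have c2 : (c.2 == e.2) = (c == e).
    apply/eqP/eqP => [ce|->//].
    have := no_triple dc; rewrite ce => /(_ _ (double_sym de)).
    by move: ce; case: (c) (e) => [? ?] [? ?] /= -> ->.
  split=> //; apply/eqP => ce.
  by move: oc; rewrite ce; have /over_under := de => h; move: oe => /h.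
by move=> c /chordP[dc _]; apply/sgz_pm1/double_transverse.
Qed.

Lemma HE D n :
  H D n = wH (chords (gauss D)) (csign (gauss D)) (inter <%R) n.
Proof. exact/H_gaussE/gauss_simple. Qed.

(** Computes H over any labelling of the chords, so that two diagrams can be compared over common
    labels. *)
Lemma H_reindex D n (T : eqType) (s : seq T) (f : T -> R * R) sg I :
    uniq s -> {in s &, injective f} ->
    (forall c, c \in chords (gauss D) <-> exists2 x, x \in s & c = f x) ->
    {in s, forall x, csign (gauss D) (f x) = sg x} ->
    {in s &, forall x y, inter <%R (f x) (f y) = I x y} ->
  H D n = wH s sg I n.
Proof.
move=> us fI fs sgE IE; rewrite HE.
have ps : perm_eq (chords (gauss D)) [seq f x | x <- s].
  apply: uniq_perm; rewrite ?fset_uniq // ?map_inj_in_uniq // => c.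
  by apply/idP/mapP; rewrite fs.
rewrite (@wH_eq _ _ _ _ (csign (gauss D)) _ (inter <%R) _ ps) //.
by rewrite wH_map; apply: wH_eq.
Qed.

(** Reversing the order complements each comparison of distinct points, and the constants cancel in
    the alternating sum. *)
Lemma inter_antimono (f : R -> R) c e :
    {mono f : x y /~ x < y} ->
    c.1 != e.1 -> c.1 != e.2 -> c.2 != e.1 -> c.2 != e.2 ->
  inter <%R (f c.1, f c.2) (f e.1, f e.2) = - inter <%R c e.
Proof.
move=> fm; rewrite /inter /side; case: c e => [a b] [x y] /= ax ay bx byy.
have fI : injective f.
  by move=> u v uv; have [h|h|//] := ltgtP u v; move: h; rewrite -fm uv ltxx.
have -> : ((f x, f y) == (f a, f b)) = false.
  by apply/negP => /eqP[/fI xa]; rewrite xa eqxx in ax.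
have -> : ((x, y) == (a, b)) = false.
  by apply/negP => /eqP[xa]; rewrite xa eqxx in ax.
rewrite !fm; move: ax ay bx byy.
by case: (ltgtP a x); case: (ltgtP a y); case: (ltgtP b x); case: (ltgtP b y).
Qed.

Definition tinv : {freeg exponent / int} -> {freeg exponent / int} :=
  fglift (fun x : exponent => << (x.1, - x.2) >>).

HB.instance Definition _ := GRing.isZmodMorphism.Build _ _ tinv
  (@lift_is_additive int exponent _ _).

Lemma tinv_texp k f : tinv (texp k f) = texp k (- f).
Proof. exact: fglift_texp. Qed.

Lemma tinv_tone : tinv tone = tone.
Proof. by rewrite /tinv liftU scale1r oppr0. Qed.

Lemma H_inverse D : H (inverse D) = subst_tinv (H D).
Proof.
apply/funext => n; have [S1 S2 _] := gauss_simple D.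
pose f c : R * R := (1 - c.1, 1 - c.2).
have fK : involutive f by move=> [a b]; rewrite /f /= !subKr.
have fC c : c \in chords (gauss (inverse D)) = (f c \in chords (gauss D)).
  apply/chordP/chordP => -[].
    by move=> /rev_double.
  by move=> /rev_double'/=; rewrite subKr.
rewrite (@H_reindex _ n _ (chords (gauss D)) f (csign (gauss D))
  (fun c e => - inter <%R c e)).
- rewrite wH_opp /subst_tinv HE /wH -/tinv raddf_sum; apply: eq_bigr => c _.
  (* Scaling by a sign is taking an integer multiple, which any additive map respects. *)
  rewrite -[csign _ _]intz !scaler_int raddfMz raddfB.
  by rewrite /= tinv_texp tinv_tone.
- exact: fset_uniq.
- by move=> c e _ _; apply: (can_inj fK).
- move=> c; rewrite fC; split=> [h|[x h ->]]; last by rewrite fK.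
  by exists (f c); rewrite ?fK.
(* Both tangent vectors at a crossing are negated, so its sign is kept. *)
- move=> c _ /=; rewrite !rev_curve_derive1; try exact: curve_derivable.
  by rewrite /= !subKr /cross /= !mulrNN.
- move=> c e cC eC.
  have [->|ce] := eqVneq c e; first by rewrite /inter !eqxx oppr0.
  have [a1 a2 a3] := S2 c e cC eC; have [_ _ a4] := S2 e c eC cC.
  rewrite (inter_antimono (f := fun x => 1 - x)) ?a1 ?a2 // 1?eq_sym //.
  by move=> x y /=; rewrite ltrD2l ltrN2.
Qed.

End Chords.

(** * Planar isotopies *)

Section Calculus.
Variable R : realType.
Implicit Types (h : R * R -> R * R) (v w : R * R).

Lemma is_derive_comp (V W : normedModType R) (k : V -> W) (g : R -> V) t dg :
  differentiable k (g t) -> is_derive t 1 g dg ->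
  is_derive t 1 (k \o g) ('d k (g t) dg).
Proof.
move=> dk [gt <-]; have dgt : differentiable g t by apply/derivable1_diffP.
have dc : differentiable (k \o g) t by apply: differentiable_comp.
apply: DeriveDef; first exact/derivable1_diffP.
by rewrite deriveE // diff_comp //= deriveE.
Qed.

Lemma add_fst v w : (v + w).1 = v.1 + w.1. Proof. by []. Qed.
Lemma add_snd v w : (v + w).2 = v.2 + w.2. Proof. by []. Qed.
Lemma scale_fst (a : R) v : (a *: v).1 = a * v.1. Proof. by []. Qed.
Lemma scale_snd (a : R) v : (a *: v).2 = a * v.2. Proof. by []. Qed.

Lemma crossZ (a b : R) v w : cross (a *: v) (b *: w) = a * b * cross v w.
Proof. by rewrite /cross !scale_fst !scale_snd; ring. Qed.

Definition jacobian h p := cross (tangent h p (1, 0)) (tangent h p (0, 1)).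

(** A linear map of the plane multiplies cross products by its determinant. *)
Lemma cross_tangent h p v w :
  cross (tangent h p v) (tangent h p w) = jacobian h p * cross v w.
Proof.
have E u :
    tangent h p u = u.1 *: tangent h p (1, 0) + u.2 *: tangent h p (0, 1).
  rewrite /tangent -!linearZ -linearD; apply: (congr1 ('d h p)).
  case: u => a b; apply: (congr2 pair) => /=.
    by rewrite scaler0 addr0; apply/esym/mulr1.
  by rewrite scaler0 add0r; apply/esym/mulr1.
rewrite [tangent h p v]E [tangent h p w]E /jacobian /cross.
rewrite !add_fst !add_snd !scale_fst !scale_snd; ring.
Qed.

Lemma diffeomorphism_inj h : diffeomorphism h -> injective h.
Proof. by move=> [_ [g [_ hK _]]]; apply: can_inj hK. Qed.

Lemma diffeomorphism_differentiable h p :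
  diffeomorphism h -> differentiable h p.
Proof. by move=> [[]]. Qed.

(** The chain rule for the inverse map composed with h writes 1 as a product with [jacobian h p] as
    a factor. *)
Lemma jacobian_neq0 h p : diffeomorphism h -> jacobian h p != 0.
Proof.
move=> [[dh _] [g [[dg _] hK _]]]; apply/eqP => h0.
have : cross (tangent g (h p) (tangent h p (1, 0)))
             (tangent g (h p) (tangent h p (0, 1))) = 1.
  have E v : tangent g (h p) (tangent h p v) = v.
    have gh : g \o h = id by apply/funext => q /=; rewrite hK.
    rewrite /tangent -[LHS]/(('d g (h p) \o 'd h p) v) -diff_comp // gh.
    by rewrite diff_val.
  by rewrite !E /cross /=; ring.
rewrite cross_tangent -/(jacobian h p) h0 mulr0 => /esym/eqP.
by rewrite oner_eq0.
Qed.

Lemma within_slice (T : topologicalType) (G : R * (R * R) -> T) p :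
  {within [set q | 0 <= q.1 <= 1], continuous G} ->
  {within `[0, 1], continuous (fun a => G (a, p))}.
Proof.
move=> /subspace_continuousP Gc; apply/subspace_continuousP => a a01 U.
have a01' : [set q : R * (R * R) | 0 <= q.1 <= 1] (a, p).
  by move: a01; rewrite /= in_itv.
move=> /(Gc _ a01') /= hU.
have gc : (fun x : R => (x, p)) @ a --> (a, p).
  exact: (cvg_pair (@cvg_id _ _) (@cvg_cst _ _ _ _ _)).
have h2 : nbhs a [set x | 0 <= x <= 1 -> U (G (x, p))] := gc _ hU.
have : nbhs a [set x | `[0, 1]%classic x -> U (G (x, p))].
  by apply: filterS h2 => x; rewrite /= in_itv.
exact.
Qed.

(** The Jacobian is 1 at time 0, depends continuously on the time and never vanishes, so the
    intermediate value theorem keeps it positive. *)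
Lemma isotopy_jacobian_gt0 (F : R -> R * R -> R * R) p :
  ambient_isotopy F -> 0 < jacobian (F 1) p.
Proof.
move=> [F0 Fdiff _ Fcont].
pose J a := jacobian (F a) p.
have J0 : J 0 = 1.
  have -> : J 0 = jacobian id p by congr (jacobian _ p); apply/funext/F0.
  by rewrite /jacobian /tangent !diff_val /cross /=; ring.
have Jc : {within `[0, 1], continuous J}.
  have Tc v : {within `[0, 1], continuous (fun a => tangent (F a) p v)}.
    exact: (@within_slice _ (fun q => tangent (F q.1) q.2 v) p (Fcont v)).
  have T1 v : {within `[0, 1], continuous (fun a => (tangent (F a) p v).1)}.
    apply: (@within_continuous_comp _ _ _ _ (fun a => tangent (F a) p v) fst _
      (Tc v)) => x _; exact: cvg_fst.
  have T2 v : {within `[0, 1], continuous (fun a => (tangent (F a) p v).2)}.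
    apply: (@within_continuous_comp _ _ _ _ (fun a => tangent (F a) p v) snd _
      (Tc v)) => x _; exact: cvg_snd.
  by move=> a; apply: (@cvgB R); apply: cvgM;
    [exact: T1|exact: T2|exact: T2|exact: T1].
rewrite ltNge; apply/negP => J1.
have [] := @IVT R J 0 1 0 ler01 Jc.
  by rewrite J0 ge_min le_max J1 ler01 orbT.
move=> a; rewrite in_itv /= => /Fdiff/jacobian_neq0 h Ja.
by have := h p; rewrite -/(J a) Ja eqxx.
Qed.

End Calculus.

Section PlanarIsotopy.
Variable R : realType.
Implicit Types (D E : diagram R) (c e : R * R).

Lemma near_unit_itv (t : R) : 0 < t < 1 -> \forall x \near t, 0 <= x <= 1.
Proof.
move=> t01; have /(_ t) h := @near_in_itvoo R 0 1.
have : \forall x \near t, x \in `]0, 1[ by apply: h; rewrite in_itv.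
by apply: filterS => x; rewrite in_itv /= => /andP[/ltW -> /ltW ->].
Qed.

Section Reparametrization.
Variable f : R -> R.
Hypothesis rf : reparametrization f.

Lemma reparam_cont : {within `[0, 1], continuous f}.
Proof.
by case: rf => _ _ df _ _; apply: derivable_within_continuous => x _.
Qed.

Lemma reparam_lt : {in `[0, 1] &, {mono f : x y / x < y}}.
Proof.
case: rf => _ _ df _ f'0.
have h x y : x \in `[0, 1] -> y \in `[0, 1] -> x < y -> f x < f y.
  rewrite !in_itv /= => /andP[x0 _] /andP[_ y1] xy.
  apply: (@gtr0_derive1_incr _ f 0 1) => // [z|]; last exact: reparam_cont.
  by rewrite in_itv /= => /andP[z0 z1]; rewrite f'0 // !ltW.
move=> x y x01 y01; have [xy|yx|->] := ltgtP x y; first exact: h.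
  by apply/negbTE; rewrite -leNgt ltW // h.
by rewrite ltxx.
Qed.

Lemma reparam_inj : {in `[0, 1] &, injective f}.
Proof.
move=> x y x01 y01 fxy; have [xy|yx|//] := ltgtP x y.
  by move: xy; rewrite -reparam_lt // fxy ltxx.
by move: yx; rewrite -reparam_lt // fxy ltxx.
Qed.

Lemma reparam_itv x : x \in `[0, 1] -> f x \in `[0, 1].
Proof.
have [f0 f1 _ _ _] := rf.
have o0 : (0 : R) \in `[0, 1] by rewrite in_itv /= lexx ler01.
have o1 : (1 : R) \in `[0, 1] by rewrite in_itv /= lexx ler01.
move=> x01; move: (x01); rewrite !in_itv /= => /andP[x0 x1].
by rewrite -{1}f0 -{1}f1 !leNgt !reparam_lt // -!leNgt x0 x1.
Qed.

Lemma reparam_surj y : y \in `[0, 1] -> exists2 x, x \in `[0, 1] & f x = y.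
Proof.
have [f0 f1 _ _ _] := rf; rewrite in_itv /= => y01.
apply: (IVT ler01 reparam_cont).
by rewrite f0 f1 minEle maxEle ler01.
Qed.

End Reparametrization.

Lemma inter_map (P Q : eqType) (f : P -> Q) (lt : rel P) (lt' : rel Q)
    (c e : P * P) :
    ((f e.1, f e.2) == (f c.1, f c.2)) = (e == c) ->
    {in [:: e.1; e.2] & [:: c.1; c.2], forall x y, lt' (f x) (f y) = lt x y} ->
  inter lt' (f c.1, f c.2) (f e.1, f e.2) = inter lt c e.
Proof.
by move=> ce fm; rewrite /inter ce /side /= !fm ?inE ?eqxx ?orbT.
Qed.

Lemma H_isotopy D E : planar_isotopic D E -> H D = H E.
Proof.
move=> [F [f [iF rf DE]]]; apply/funext => n.
have [F0 Fd _ _] := iF; have [f0 f1 df _ f'0] := rf.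
have hF1 : diffeomorphism (F 1) by apply: Fd; rewrite lexx ler01.
have FI := diffeomorphism_inj hF1.
(* E agrees with the transported curve only on [0,1], so the derivatives are compared at interior
   points; double points are interior. *)
have dE t : 0 < t < 1 -> (E^`())%classic t =
    (f^`())%classic t *: tangent (F 1) (D (f t)) ((D^`())%classic (f t)).
  move=> t01; rewrite derive1E.
  have dD u : differentiable D u.
    by apply/derivable1_diffP; exact: curve_derivable.
  have ft : is_derive t 1 f ((f^`())%classic t).
    by rewrite derive1E; exact: derivableP.
  have Dft : is_derive t 1 (D \o f)
      ((f^`())%classic t *: (D^`())%classic (f t)).
    have -> : (f^`())%classic t *: (D^`())%classic (f t) =
        'd D (f t) ((f^`())%classic t).
      rewrite -[X in 'd D _ X]mulr1 -[_ * 1]/(_ *: 1) linearZ /=.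
      by rewrite -deriveE ?derive1E.
    exact: is_derive_comp.
  have : is_derive t 1 (F 1 \o (D \o f))
      ('d (F 1) (D (f t)) ((f^`())%classic t *: (D^`())%classic (f t))).
    by apply: is_derive_comp => //; exact: diffeomorphism_differentiable.
  rewrite linearZ /= => h; rewrite /tangent.
  apply: derive_val; apply: (near_eq_is_derive _ h).
  by near=> x; rewrite (DE x _).1 //; near: x; exact: near_unit_itv.
rewrite [RHS]HE.
pose g (c : R * R) : R * R := (f c.1, f c.2).
have i01 (x : R) : (x \in `[0, 1]) = (0 <= x <= 1) by rewrite in_itv.
have E01 c : c \in chords (gauss E) -> c.1 \in `[0, 1] /\ c.2 \in `[0, 1].
  by move=> /chordP[[h1 h2 _ _] _]; rewrite !i01.
have gE c : c.1 \in `[0, 1] -> c.2 \in `[0, 1] ->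
    (c \in chords (gauss E)) = (g c \in chords (gauss D)).
  move=> c1 c2; have g1 := reparam_itv rf c1; have g2 := reparam_itv rf c2.
  have [e1 o1] := DE c.1 c1; have [e2 o2] := DE c.2 c2.
  rewrite !i01 in c1 c2 g1 g2.
  apply/chordP/chordP => -[[h1 h2 h3 h4] /o1 h5]; (split; last exact: h5);
    split => //.
  - by apply: contra h3 => /eqP /(reparam_inj rf) ->; rewrite ?i01.
  - by apply: FI; rewrite -e1 -e2.
  - by apply: contra h3 => /eqP /= ->.
  - by rewrite e1 e2 /= h4.
have gI : {in chords (gauss E) &, injective g}.
  move=> [c1 c2] [e1 e2] /E01[/= h1 h2] /E01[/= h3 h4].
  by move=> [/(reparam_inj rf) -> // /(reparam_inj rf) ->].
apply: (@H_reindex _ _ _ _ _ g).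
- exact: fset_uniq.
- exact: gI.
- move=> c; split=> [cD|[x xE ->]]; last first.
    by have [x1 x2] := E01 _ xE; rewrite -gE.
  have /chordP[[c1 c2 _ _] _] := cD; rewrite -!i01 in c1 c2.
  have [x x01 fx] := reparam_surj rf c1; have [y y01 fy] := reparam_surj rf c2.
  have cg : c = g (x, y) by rewrite /g /= fx fy; case: (c).
  by exists (x, y); rewrite // gE // -cg.
- move=> c /chordP[dc _]; have [c1 c2] := double_in01 dc.
  have [h1 h2 _ c12] := dc.
  (* Both branches of a crossing are transported by the differential of [F 1] at one and the same
     point, so the cross product only gains positive factors. *)
  have e12 : D (f c.2) = D (f c.1).
    by apply: FI; rewrite -(DE _ h1).1 -(DE _ h2).1.
  rewrite /= (dE _ c1) (dE _ c2) e12 crossZ cross_tangent !sgzM.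
  rewrite (gtr0_sgz (f'0 _ h1)) (gtr0_sgz (f'0 _ h2)).
  by rewrite (gtr0_sgz (isotopy_jacobian_gt0 _ iF)) !mul1r.
- move=> c e cE eE; have [c1 c2] := E01 _ cE; have [e1 e2] := E01 _ eE.
  apply: inter_map.
    by apply/eqP/eqP => [|->//]; apply: gI.
  move=> x y; rewrite !inE.
  by move=> /orP[] /eqP -> /orP[] /eqP ->; rewrite reparam_lt.
Unshelve. all: by end_near. Qed.

End PlanarIsotopy.

(** * Local moves *)

Section Strands.
Variables (R : realType) (n : nat) (h : R * R -> R * R) (p r : 'I_n -> R).
Variable lev : 'I_n -> nat.
Implicit Types (D E : diagram R) (k m : 'I_n -> R -> R * R) (c e : R * R).
Implicit Types (i j : 'I_n) (s t u v : R).

Definition strand_at i u : R := p i + r i * u.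
Local Notation at_ := strand_at.

(** The quotient is the model parameter of s on the strand i. The strict inequality makes this an
    open condition. *)
Definition outside s : bool := [forall i, 2 < `|(s - p i) / r i|].

Definition box : set (R * R) := [set q | `|q.1| <= 2 /\ `|q.2| <= 2].

(* The part of [local_move] that concerns one of the two diagrams, the strands
   being [k]. *)
Record strands E k : Prop := Strands {
  strands_diffeo : diffeomorphism h;
  strands_orient : orientation_preserving h;
  strands_r : forall i, r i != 0;
  strands_lev : injective lev;
  strands_in01 : forall i u, `|u| <= 2 -> 0 < at_ i u < 1;
  strands_disjoint : forall i j u v,
    i != j -> `|u| <= 2 -> `|v| <= 2 -> at_ i u != at_ j v;
  strands_eq : forall i u, `|u| <= 2 -> E (at_ i u) = h (k i u);
  strands_over : forall i j u v, i != j -> `|u| <= 2 -> `|v| <= 2 ->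
    k i u = k j v -> (over E (at_ i u) <-> (lev j < lev i)%N);
  strands_box : forall i u, `|u| <= 2 -> box (k i u);
  strands_out : forall s, 0 <= s <= 1 -> outside s -> ~ (h @` box) (E s)
}.

Lemma outside_avoidP s : (forall i, r i != 0) ->
  reflect (forall i u, `|u| <= 2 -> s != at_ i u) (outside s).
Proof.
move=> r0.
apply: (iffP forallP) => [so i u u2|so i].
  apply/eqP => E1; have := so i; rewrite E1 /at_ addrC addKr mulrC mulKf //.
  by rewrite ltNge u2.
rewrite ltNge; apply/negP => u2; have := so i _ u2.
by rewrite /at_ mulrC divfK // addrC subrK eqxx.
Qed.

Section OneDiagram.
Variables (E : diagram R) (k : 'I_n -> R -> R * R).
Hypothesis S : strands E k.

Lemma outsideP s :
  reflect (forall i u, `|u| <= 2 -> s != at_ i u) (outside s).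
Proof. exact/outside_avoidP/(strands_r S). Qed.

Lemma insideP s : ~~ outside s -> exists i u, `|u| <= 2 /\ s = at_ i u.
Proof.
rewrite /outside negb_forall => /existsP[i]; rewrite -leNgt => u2.
exists i, ((s - p i) / r i); split=> //.
by rewrite /at_ mulrC divfK ?(strands_r S) // addrC subrK.
Qed.

Lemma inside_at i u : `|u| <= 2 -> outside (at_ i u) = false.
Proof. by move=> u2; apply/negP => /outsideP/(_ i u u2); rewrite eqxx. Qed.

(** The parameters of the strand i form an interval, and s lies on one side of it. *)
Lemma avoid_lt s i u v : (forall x, `|x| <= 2 -> s != at_ i x) ->
  `|u| <= 2 -> `|v| <= 2 -> (s < at_ i u) = (s < at_ i v).
Proof.
move=> hs; have ri := strands_r S i; pose w := (s - p i) / r i.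
have sE : s = at_ i w by rewrite /at_ /w mulrC divfK // addrC subrK.
have {hs} : 2 < `|w|.
  by rewrite ltNge; apply/negP => /hs; rewrite -sE eqxx.
rewrite sE /at_ !ltrD2l !ler_norml => hs /andP[u1 u2] /andP[v1 v2].
have [r0|r0] : r i < 0 \/ 0 < r i by apply/orP; rewrite -neq_lt.
  rewrite !ltr_nM2l //; move: hs; rewrite lter_normr => /orP[] hs.
    by apply/idP/idP => ?; lra.
  by apply/idP/idP => ?; lra.
rewrite !ltr_pM2l //; move: hs; rewrite lter_normr => /orP[] hs.
  by apply/idP/idP => ?; lra.
by apply/idP/idP => ?; lra.
Qed.

Lemma avoid_gt s i u v : (forall x, `|x| <= 2 -> s != at_ i x) ->
  `|u| <= 2 -> `|v| <= 2 -> (at_ i u < s) = (at_ i v < s).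
Proof.
move=> hs u2 v2; rewrite ltNge [RHS]ltNge !le_eqVlt !(negbTE (hs _ _)) //=.
by rewrite (avoid_lt hs u2 v2).
Qed.

Lemma outside_lt s i u v : outside s -> `|u| <= 2 -> `|v| <= 2 ->
  (s < at_ i u) = (s < at_ i v).
Proof. by move=> /outsideP so; exact: (avoid_lt (so i)). Qed.

Lemma outside_gt s i u v : outside s -> `|u| <= 2 -> `|v| <= 2 ->
  (at_ i u < s) = (at_ i v < s).
Proof. by move=> /outsideP so; exact: (avoid_gt (so i)). Qed.

(** Distinct strands occupy disjoint parameter intervals. *)
Lemma strand_lt i j u v u' v' : i != j ->
    `|u| <= 2 -> `|v| <= 2 -> `|u'| <= 2 -> `|v'| <= 2 ->
  (at_ i u < at_ j v) = (at_ i u' < at_ j v').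
Proof.
move=> ij u2 v2 u'2 v'2; have ji : j != i by rewrite eq_sym.
rewrite (avoid_lt (v := v')) // => [|x x2]; last exact: (strands_disjoint S).
by rewrite (avoid_gt (v := u')) // => x x2; exact: (strands_disjoint S).
Qed.

Lemma at_inj i : injective (at_ i).
Proof. by move=> u v /addrI /(mulfI (strands_r S i)). Qed.

(** Off the strands the curve avoids the image of the box, in which the strands lie. *)
Lemma double_outside s t : double_point E s t -> outside s -> outside t.
Proof.
move=> [s01 t01 st Est] so; apply/contraT => /insideP[i [u [u2 tE]]].
case: (strands_out S s01 so); exists (k i u); first exact: (strands_box S).
by rewrite Est tE (strands_eq S).
Qed.

(** Both ends lie on strands by [double_outside], and the injectivity of h turns the crossing into
    one of the model. *)
Lemma inner_chord c : c \in chords (gauss E) -> ~~ outside c.1 ->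
  exists i j u v, [/\ `|u| <= 2 /\ `|v| <= 2, c = (at_ i u, at_ j v),
    k i u = k j v, at_ i u != at_ j v & i != j -> (lev j < lev i)%N].
Proof.
move=> /chordP[dc oc] /[dup] ic /insideP[i [u [u2 c1]]].
have : ~~ outside c.2.
  by apply: contra ic => ho; exact: double_outside (double_sym dc) ho.
move=> /insideP[j [v [v2 c2]]]; exists i, j, u, v.
case: dc => _ _; rewrite c1 c2 => uv.
rewrite !(strands_eq S) // => /(diffeomorphism_inj (strands_diffeo S)) kE.
split=> //; first by rewrite -c1 -c2; case: (c).
by move=> ij; rewrite c1 in oc; apply/(strands_over S ij u2 v2 kE).
Qed.

Lemma strand_double i j u v : `|u| <= 2 -> `|v| <= 2 -> at_ i u != at_ j v ->
  k i u = k j v -> double_point E (at_ i u) (at_ j v).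
Proof.
move=> u2 v2 uv kE; split=> //; last by rewrite !(strands_eq S) // kE.
  by have /andP[/ltW -> /ltW ->] := strands_in01 S i u2.
by have /andP[/ltW -> /ltW ->] := strands_in01 S j v2.
Qed.

Lemma strand_chord i j u v : `|u| <= 2 -> `|v| <= 2 -> k i u = k j v ->
  (lev j < lev i)%N -> (at_ i u, at_ j v) \in chords (gauss E).
Proof.
move=> u2 v2 kE ji.
have ij : i != j by apply: contraTneq ji => ->; rewrite ltnn.
apply/chordP => /=; split; last exact/(strands_over S ij u2 v2 kE).
by apply: strand_double => //; apply: (strands_disjoint S).
Qed.

Lemma near_lt2 u : `|u| < 2 -> \forall x \near u, `|x| <= 2.
Proof.
move=> u2; have h2 : \forall x \near u, `|x| < 2.
  exact: (@cvgr_norm_lt _ _ _ _ _ id u (@cvg_id _ _)) u2.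
by apply: filterS h2 => x /ltW.
Qed.

(** Near u, E after [at_ i] coincides with h after [k i], and the chain rule applies to both. The
    strict bound on u provides the neighbourhood. *)
Lemma strand_derive i u dk : `|u| < 2 -> is_derive u 1 (k i) dk ->
  r i *: (E^`())%classic (at_ i u) = tangent h (k i u) dk.
Proof.
move=> u2 dki.
have dat : is_derive u 1 (at_ i) (r i).
  change (is_derive u 1 (fun x => p i + r i * x) (r i)).
  by apply: is_derive_eq; rewrite add0r scaler1 mul1r.
have dE : differentiable E (at_ i u).
  by apply/derivable1_diffP; exact: curve_derivable.
have h1 : is_derive u 1 (E \o at_ i) ('d E (at_ i u) (r i)).
  exact: is_derive_comp.
have h2 : is_derive u 1 (h \o k i) ('d h (k i u) dk).
  by apply: is_derive_comp => //;
    apply/diffeomorphism_differentiable/(strands_diffeo S).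
have E1 : 'd E (at_ i u) (r i) = r i *: (E^`())%classic (at_ i u).
  rewrite -[X in 'd E _ X]mulr1 -[_ * 1]/(_ *: 1) linearZ /=.
  by rewrite -deriveE ?derive1E.
rewrite -E1 -[LHS](@derive_val _ _ _ _ _ _ _ h1).
rewrite /tangent -[RHS](@derive_val _ _ _ _ _ _ _ h2).
apply: near_eq_derive; near=> x; rewrite /= (strands_eq S) //.
by near: x; exact: near_lt2.
Unshelve. all: by end_near. Qed.

(** The tangents of E are the images of the model tangents under one orientation-preserving
    differential, divided by [r i] and [r j]. *)
Lemma strand_sign i j u v du dv : `|u| < 2 -> `|v| < 2 -> k i u = k j v ->
    is_derive u 1 (k i) du -> is_derive v 1 (k j) dv ->
  csign (gauss E) (at_ i u, at_ j v) =
    sgz (r i) * sgz (r j) * sgz (cross du dv).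
Proof.
move=> u2 v2 kE hu hv.
have hi := strand_derive u2 hu; have hj := strand_derive v2 hv.
have : sgz (cross (r i *: (E^`())%classic (at_ i u))
                  (r j *: (E^`())%classic (at_ j v))) = sgz (cross du dv).
  rewrite hi hj kE cross_tangent sgzM gtr0_sgz ?mul1r //.
  exact: (strands_orient S).
rewrite crossZ !sgzM => <- /=.
have sq l : sgz (r l) * sgz (r l) = 1.
  by have := sgz_pm1 (strands_r S l); rewrite !inE => /orP[] /eqP ->.
by rewrite mulrA mulrACA !sq !mul1r.
Qed.

End OneDiagram.

(** A point outside the strands compares in the same way with all points of a strand, so the ends of
    a chord can slide along their strands. *)
Lemma inter_outer E k e i j u v u' v' : strands E k ->
    outside e.1 -> outside e.2 ->
    `|u| <= 2 -> `|v| <= 2 -> `|u'| <= 2 -> `|v'| <= 2 ->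
  inter <%R (at_ i u, at_ j v) e = inter <%R (at_ i u', at_ j v') e /\
  inter <%R e (at_ i u, at_ j v) = inter <%R e (at_ i u', at_ j v').
Proof.
move=> S e1 e2 u2 v2 u'2 v'2.
have ne x y : `|x| <= 2 -> (e == (at_ i x, at_ j y)) = false.
  by move=> x2; apply/eqP => ee; move: e1; rewrite ee (inside_at S).
rewrite /inter ![(_, _) == e]eq_sym !ne // /side /=.
rewrite !(outside_lt S _ _ u2 u'2) // !(outside_lt S _ _ v2 v'2) //.
by rewrite !(outside_gt S _ _ u2 u'2) // !(outside_gt S _ _ v2 v'2).
Qed.

(** Once both ends are slid to the same point of the strand, the chord is degenerate and its entries
    vanish. *)
Lemma inter_outer_same E k e i u v : strands E k ->
    outside e.1 -> outside e.2 -> `|u| <= 2 -> `|v| <= 2 ->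
  inter <%R (at_ i u, at_ i v) e = 0 /\ inter <%R e (at_ i u, at_ i v) = 0.
Proof.
move=> S e1 e2 u2 v2; have [-> ->] := inter_outer i i S e1 e2 u2 v2 u2 u2.
rewrite /inter /side /=; split; case: ifP => // _; last by rewrite !subrr.
by rewrite !subrr.
Qed.

(** The left summand labels the crossings in the box, whose positions depend on the side of the
    move; the chords outside are their own labels. *)
Definition place (K : Type) (pos : K -> R * R) (x : K + R * R) : R * R :=
  match x with inl a => pos a | inr c => c end.

Lemma H_strands E k (outs : seq (R * R)) (K : eqType) (ks : seq K) pos sg q :
    strands E k -> uniq outs ->
    (forall c, (c \in outs) = (c \in chords (gauss E)) && outside c.1) ->
    uniq ks -> {in ks &, injective pos} ->
    {in ks, forall a, pos a \in chords (gauss E) /\ ~~ outside (pos a).1} ->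
    (forall c, c \in chords (gauss E) -> ~~ outside c.1 ->
      exists2 a, a \in ks & c = pos a) ->
    {in ks, forall a, csign (gauss E) (pos a) = sg (inl a)} ->
    {in outs, forall c, csign (gauss E) c = sg (inr c)} ->
  H E q = wH ([seq inl a | a <- ks] ++ [seq inr c | c <- outs]) sg
    (fun x y => inter <%R (place pos x) (place pos y)) q.
Proof.
move=> S uo outsE uk posI posE inE' sgk sgo.
have mem_l a : (inl a \in [seq inl a | a <- ks] ++ [seq inr c | c <- outs]) =
  (a \in ks).
  rewrite mem_cat mem_map; last by move=> ? ? [].
  by rewrite orbC; case: mapP => // -[].
have mem_r c : (inr c \in [seq inl a | a <- ks] ++ [seq inr c | c <- outs]) =
  (c \in outs).
  rewrite mem_cat [X in _ || X]mem_map; last by move=> ? ? [].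
  by case: mapP => // -[].
apply: (@H_reindex _ _ _ _ _ (place pos)) => //.
- rewrite cat_uniq !map_inj_uniq ?uk ?uo ?andbT //=; try by move=> ? ? [].
  by apply/hasPn => x /mapP[c _ ->]; apply/mapP => -[].
- move=> [a|c] [b|e]; rewrite ?mem_l ?mem_r ?outsE /=.
  + by move=> ak bk /posI ->.
  + by move=> /posE[_ o] /andP[_ e1] ce; rewrite ce e1 in o.
  + by move=> /andP[_ e1] /posE[_ o] ce; rewrite -ce e1 in o.
  + by move=> _ _ ->.
- move=> c; split=> [cE|[[a|e]]]; last 2 first.
  + by rewrite mem_l => /posE[aE _] ->.
  + by rewrite mem_r outsE => /andP[eE _] ->.
  have [co|ci] := boolP (outside c.1).
    by exists (inr c); rewrite // mem_r outsE cE.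
  by have [a ak ->] := inE' c cE ci; exists (inl a); rewrite ?mem_l.
- by move=> [a|c]; rewrite ?mem_l ?mem_r => ?; [exact: sgk|exact: sgo].
Qed.

Definition agree_outside D E : Prop := forall s, 0 <= s <= 1 -> outside s ->
  E s = D s /\ (over E s <-> over D s).

Lemma agree_sym D E : agree_outside D E -> agree_outside E D.
Proof. by move=> DE s s01 so; have [-> [h1 h2]] := DE s s01 so; split. Qed.

(** Being outside the strands is an open condition, so the two curves agree near s. *)
Lemma outer_derive D E s : agree_outside D E -> 0 < s < 1 -> outside s ->
  (E^`())%classic s = (D^`())%classic s.
Proof.
move=> DE s01 so; rewrite !derive1E; apply: near_eq_derive.
have near_o : \forall x \near s, outside x.
  have : \forall x \near s, forall i, 2 < `|(x - p i) / r i|.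
    apply: (@filter_forall R 'I_n (fun i x => 2 < `|(x - p i) / r i|) (nbhs s)).
    move=> i; have /forallP/(_ i) hi := so.
    have hc : (fun x : R => (x - p i) / r i) @ s --> (s - p i) / r i.
      by apply: cvgMl; apply: (@cvgB R); [exact: cvg_id|exact: cvg_cst].
    exact: cvgr_norm_gt hc _ hi.
  by apply: filterS => x hx; apply/forallP.
near=> x; have [//|//|->//] := DE x; near: x => //.
exact: near_unit_itv.
Unshelve. all: by end_near. Qed.

Lemma outer_chord D E m c : strands D m -> agree_outside D E ->
  c \in chords (gauss D) -> outside c.1 -> c \in chords (gauss E).
Proof.
move=> S DE /chordP[dc oc] c1; have c2 := double_outside S dc c1.
have [h1 h2 h3 h4] := dc; have [e1 o1] := DE _ h1 c1; have [e2 _] := DE _ h2 c2.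
by apply/chordP; split; [split; rewrite // e1 e2|apply/o1].
Qed.

Lemma outer_sign D E m c : strands D m -> agree_outside D E ->
  c \in chords (gauss D) -> outside c.1 ->
  csign (gauss E) c = csign (gauss D) c.
Proof.
move=> S DE /chordP[dc oc] c1; have c2 := double_outside S dc c1.
have [h1 h2] := double_in01 dc.
by rewrite /= (outer_derive DE h1 c1) (outer_derive DE h2 c2).
Qed.

End Strands.

Lemma local_move_strands (R : realType) n (m m' : n.-tuple (R -> R * R))
    (D E : diagram R) :
    (forall i u, `|u| <= 2 -> box (tnth m i u)) ->
    (forall i u, `|u| <= 2 -> box (tnth m' i u)) ->
    local_move m m' D E ->
  exists h p r lev, [/\ strands h p r lev D (tnth m),
    strands h p r lev E (tnth m') & agree_outside p r D E].
Proof.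
move=> bm bm' [h [p [r [lev]]]] /= [hd ho [r0 li] [h1 h2 h3 [ov ov'] h4]].
have hout s : 0 <= s <= 1 -> outside p r s ->
    [/\ E s = D s, over E s <-> over D s & ~ (h @` @box R) (D s)].
  by move=> s01 /(@outside_avoidP _ _ p r s r0) so; have [a b c] := h4 s s01 so.
exists h, p, r, lev; split.
- apply: (@Strands _ _ h p r lev D (tnth m) hd ho r0 li h1 h2 _ ov bm _) =>
  [i u /(h3 i)[]//|s s01 so].
  by have [] := hout s s01 so.
- apply: (@Strands _ _ h p r lev E (tnth m') hd ho r0 li h1 h2 _ ov' bm' _) =>
  [i u /(h3 i)[]//|s s01 so].
  by have [-> ] := hout s s01 so.
- by move=> s s01 so; have [] := hout s s01 so.
Qed.

(** * The bump function of the model strands *)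

Section Models.
Variable R : realType.
Implicit Types (u v s : R).

Lemma is_derive_pair (f g : R -> R) (u df dg : R) :
  is_derive u 1 f df -> is_derive u 1 g dg ->
  is_derive u 1 (fun x => (f x, g x)) (df, dg).
Proof.
move=> [dfu <-] [dgu <-].
have ff : differentiable f u := (derivable1_diffP f u).1 dfu.
have gg : differentiable g u := (derivable1_diffP g u).1 dgu.
apply: DeriveDef; first exact/derivable1_diffP/differentiable_pair.
by rewrite !deriveE ?diff_pair //; exact: differentiable_pair.
Qed.

Definition dbump u : R := - (4 / 9) * u * (4 - u ^+ 2).

Lemma is_derive_bump u : is_derive u 1 (@bump R) (dbump u).
Proof.
by rewrite /bump; apply: is_derive_eq; rewrite /dbump /GRing.scale /=; field.
Qed.

Lemma norm_sqr u : `|u| <= 2 -> 0 <= 4 - u ^+ 2 <= 4.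
Proof. by rewrite ler_norml => /andP[? ?]; apply/andP; split; nra. Qed.

Lemma bump_bound u : `|u| <= 2 -> 0 <= bump u <= 16 / 9.
Proof.
rewrite /bump => /norm_sqr; set x := 4 - _ => /andP[? ?].
by apply/andP; split; nra.
Qed.

Lemma bumpN u : bump (- u) = bump u. Proof. by rewrite /bump sqrrN. Qed.

Lemma bump1 : bump (1 : R) = 1. Proof. by rewrite /bump; field. Qed.

Lemma bump_eq u v :
  `|u| <= 2 -> `|v| <= 2 -> bump u = bump v -> v = u \/ v = - u.
Proof.
rewrite /bump => u2 v2 /(mulIf _) h.
have {h} : (4 - u ^+ 2) ^+ 2 = (4 - v ^+ 2) ^+ 2.
  by apply: h; rewrite invr_eq0 pnatr_eq0.
have /andP[? _] := norm_sqr u2; have /andP[? _] := norm_sqr v2.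
move=> /eqP; rewrite eqrXn2 // => /eqP /addrI /oppr_inj /esym/eqP.
by rewrite eqf_sqr => /orP[] /eqP ->; [left|right].
Qed.

Lemma bump_eq1 u : `|u| <= 2 -> bump u = 1 -> u = 1 \/ u = -1.
Proof.
move=> u2; rewrite -{1}bump1 => /esym /bump_eq; apply=> //.
by rewrite normr1 ler1n.
Qed.

Lemma bump_fix u : `|u| <= 2 -> bump u = u -> u = 1.
Proof.
move=> u2 bu; have /andP[u0 _] := bump_bound u2; rewrite bu in u0.
(* This polynomial is [9 * (bump u - u)]. A fixed point lies in [0,2] because [bump] is nonnegative,
   and there the cubic factor is negative. *)
have : (u - 1) * (u ^+ 3 + u ^+ 2 - 7 * u - 16) = 0.
  have : 9 * (bump u - u) = 0 by rewrite bu subrr mulr0.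
  by rewrite /bump => <-; field.
move=> /eqP; rewrite mulf_eq0 => /orP[|/eqP]; first by rewrite subr_eq0 => /eqP.
by move: u2; rewrite ler_norml => /andP[_ ?] ?; exfalso; nra.
Qed.

End Models.

(** * The first and second Reidemeister moves *)

Section Moves.
Variable R : realType.
Implicit Types (D E : diagram R) (u v : R) (c e : R * R).

Definition outer_chords n (p r : 'I_n -> R) D : seq (R * R) :=
  [seq c <- chords (gauss D) | outside p r c.1].

Lemma norm1_le2 : `|1 : R| <= 2. Proof. by rewrite normr1 ler1n. Qed.
Lemma normN1_le2 : `|-1 : R| <= 2. Proof. by rewrite normrN norm1_le2. Qed.

Lemma outer_chordsE n h (p r : 'I_n -> R) lev D E m m' :
    strands h p r lev D m -> strands h p r lev E m' -> agree_outside p r D E ->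
  [/\ uniq (outer_chords p r D),
      forall c, (c \in outer_chords p r D) =
        (c \in chords (gauss D)) && outside p r c.1,
      forall c, (c \in outer_chords p r D) =
        (c \in chords (gauss E)) && outside p r c.1,
      {in outer_chords p r D, forall c, outside p r c.1 /\ outside p r c.2} &
      {in outer_chords p r D, csign (gauss E) =1 csign (gauss D)}].
Proof.
move=> S S' DE; split.
- by rewrite filter_uniq ?fset_uniq.
- by move=> c; rewrite mem_filter andbC.
- move=> c; rewrite mem_filter andbC.
  have [co|] := boolP (outside p r c.1); rewrite ?andbF ?andbT //.
  apply/idP/idP => cD; first exact: (outer_chord S DE cD co).
  exact: (outer_chord S' (agree_sym DE) cD co).
- move=> c; rewrite mem_filter => /andP[co /chordP[dc _]]; split=> //.
  exact: (double_outside S dc co).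
- move=> c; rewrite mem_filter => /andP[co cD].
  exact: (outer_sign S DE cD co).
Qed.

Definition inner_chords n (p r : 'I_n -> R) D (K : eqType) (ks : seq K)
    (pos : K -> R * R) (sg : K -> int) : Prop :=
  [/\ uniq ks, {in ks &, injective pos},
      {in ks, forall a, [/\ pos a \in chords (gauss D),
        ~~ outside p r (pos a).1 & csign (gauss D) (pos a) = sg a]} &
      forall c, c \in chords (gauss D) -> ~~ outside p r c.1 ->
        exists2 a, a \in ks & c = pos a].

(** The signs of the outer chords are read off D for both sides of a move. *)
Definition sum_sign (K : Type) D (sg : K -> int) (x : K + R * R) : int :=
  match x with inl a => sg a | inr c => csign (gauss D) c end.

Definition sum_inter (K : eqType) (pos : K -> R * R) (x y : K + R * R) : int :=
  inter <%R (place pos x) (place pos y).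

Lemma H_inner n h (p r : 'I_n -> R) lev D E m (K : eqType) ks pos
    (sg : K -> int) outs q :
    strands h p r lev E m -> uniq outs ->
    (forall c, (c \in outs) = (c \in chords (gauss E)) && outside p r c.1) ->
    {in outs, csign (gauss E) =1 csign (gauss D)} ->
    inner_chords p r E ks pos sg ->
  H E q = wH ([seq inl a | a <- ks] ++ [seq inr c | c <- outs])
             (sum_sign D sg) (sum_inter pos) q.
Proof.
move=> S uo oE os [uk pI pE pS].
apply: (H_strands q S uo oE uk pI _ pS) => [a /pE[]//|a /pE[_ _ ->]//|c cE].
exact: os.
Qed.

Lemma H_Omega1 D E : Omega1 D E -> H D = H E.
Proof.
move=> DE; apply/funext => q.
have [|i u u2|h [p [r [lev [S S' DE']]]]] := local_move_strands _ _ DE.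
- move=> i u u2; rewrite (tnth_nth (fun=> 0)) (ord1 i) /= /box /=.
  by rewrite normr0 u2.
- rewrite (tnth_nth (fun=> 0)) (ord1 i) /= /box /=.
  have /andP[b0 b1] := bump_bound u2; split; last by rewrite ger0_norm //; lra.
  rewrite normrM -[leRHS]mulr1; apply: ler_pM => //.
  by rewrite ler_norml; apply/andP; split; lra.
have [uo oD oE oo os] := outer_chordsE S S' DE'.
pose a := strand_at p r ord0 (-1); pose b := strand_at p r ord0 1.
(* The kink may be of either kind, so its chord may start at either end. *)
pose c := if `[<over E a>] then (a, b) else (b, a).
have N1 := norm1_le2; have N2 := normN1_le2.
have m'E u : tnth [tuple fun u => (u * (1 - bump u), bump u)] ord0 u =
    (u * (1 - bump u), bump u).
  by rewrite (tnth_nth (fun=> 0)).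
have mE u : tnth [tuple fun u : R => (u, 0 : R)] ord0 u = (u, 0).
  by rewrite (tnth_nth (fun=> 0)).
have iD : inner_chords p r D [::] (fun _ : unit => c) (fun=> csign (gauss E) c).
  split=> // d dD di.
  have [i [j [u [v [[u2 v2] _ mm uv _]]]]] := inner_chord S dD di.
  by move: mm uv; rewrite (ord1 i) (ord1 j) !mE => -[->]; rewrite eqxx.
have ab : double_point E a b.
  apply: (strand_double S') => //.
    by rewrite (inj_eq (at_inj S' (i := _))) lt_eqF //; lra.
  by rewrite !m'E bumpN bump1; congr pair; ring.
have iE :
    inner_chords p r E [:: tt] (fun _ : unit => c) (fun=> csign (gauss E) c).
  split=> [//|[] [] //|[] _|d dE di].
    split=> //; last by rewrite /c; case: ifP => _; rewrite /= (inside_at S').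
    apply/chordP; rewrite /c; case: ifPn => /asboolP oa /=; split=> //.
      exact: double_sym.
    by apply/(over_under (double_sym ab)).
  have [i [j [u [v [[u2 v2] d_uv mm uv _]]]]] := inner_chord S' dE di.
  exists tt => //; move: mm uv d_uv dE; rewrite (ord1 i) (ord1 j) !m'E => -[].
  (* The second coordinates give v = u or v = -u. In the latter case the first ones force u = 0,
     where u and v coincide, or [bump u = 1]. *)
  move=> + buv; have [->|->] := bump_eq u2 v2 buv; first by rewrite eqxx.
  rewrite bumpN => h1; have : u * (1 - bump u) = 0 by lra.
  move=> /eqP; rewrite mulf_eq0 => /orP[/eqP ->|]; first by rewrite oppr0 eqxx.
  rewrite subr_eq0 => /eqP/esym/(bump_eq1 u2) u1 _ -> /chordP /= [_ o1].
  rewrite /c; case: ifPn => /asboolP oa; move: o1; case: u1 => ->.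
  + by move/(over_under (double_sym ab)).
  + by rewrite opprK.
  + by [].
  + by [].
have HD := H_inner (D := D) q S uo oD (fun c _ => erefl) iD.
rewrite HD (H_inner q S' uo oE os iE) /=.
rewrite wH_isolated // => -[[] _|e]; first by rewrite /sum_inter /inter eqxx.
rewrite inE /= => /mapP[d /oo [d1 d2] [->]]; rewrite /sum_inter /= /c.
by case: ifP => _; apply: (inter_outer_same _ S').
Qed.

(** Both sides are alternating sums of the same four comparisons, read in opposite directions. The
    endpoints being distinct, these are complementary and the constants cancel. *)
Lemma inter_anti D c e : c \in chords (gauss D) -> e \in chords (gauss D) ->
  inter <%R e c = - inter <%R c e.
Proof.
have [S1 S2 _] := gauss_simple D.
move=> cD eD; have [->|ce] := eqVneq c e; first by rewrite /inter eqxx oppr0.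
have [a1 a2 a3] := S2 c e cD eD; have [_ _ a4] := S2 e c eD cD.
rewrite /inter (negbTE ce) eq_sym (negbTE ce) /side.
have n11 : c.1 != e.1 by rewrite a1.
have n22 : c.2 != e.2 by rewrite a2.
have n21 : c.2 != e.1 by rewrite eq_sym.
rewrite (ltNge c.1 e.1) (ltNge c.1 e.2) (ltNge c.2 e.1) (ltNge c.2 e.2).
rewrite (le_eqVlt e.1 c.1) (le_eqVlt e.2 c.1).
rewrite (le_eqVlt e.1 c.2) (le_eqVlt e.2 c.2).
rewrite ![e.1 == _]eq_sym ![e.2 == _]eq_sym.
rewrite (negbTE n11) (negbTE n22) (negbTE n21) (negbTE a3) /=.
by do 4!case: (_ < _).
Qed.

Lemma H_Omega2 D E : Omega2 D E -> H D = H E.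
Proof.
move=> DE; apply/funext => q.
have [i u u2|i u u2|h [p [r [lev [S S' DE']]]]] := local_move_strands _ _ DE.
- rewrite (tnth_nth (fun=> 0)); case: i => [[|[|//]]] ? /=; rewrite /box /=.
    by rewrite normr0.
  by rewrite normr1 u2 ler1n.
- rewrite (tnth_nth (fun=> 0)); case: i => [[|[|//]]] ? /=; rewrite /box /=.
    by rewrite normr0.
  split=> //; have /andP[b0 b1] := bump_bound u2.
  by rewrite ler_norml; apply/andP; split; lra.
have [uo oD oE oo os] := outer_chordsE S S' DE'.
have I2P (i : 'I_2) : i = ord0 \/ i = ord_max.
  by case: i => [[|[|//]]] ?; [left|right]; apply/val_inj.
have [N1 N2] := (norm1_le2, normN1_le2).
pose m : 2.-tuple (R -> R * R) := [tuple fun u => (u, 0); fun u => (u, 1)].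
pose m' : 2.-tuple (R -> R * R) :=
  [tuple fun u => (u, 0); fun u => (u, 1 - bump u)].
rewrite -/m in S; rewrite -/m' in S'.
have m0 : tnth m ord0 = (fun u => (u, 0)) by rewrite (tnth_nth (fun=> 0)).
have m1 : tnth m ord_max = (fun u => (u, 1)) by rewrite (tnth_nth (fun=> 0)).
have m'0 : tnth m' ord0 = (fun u => (u, 0)) by rewrite (tnth_nth (fun=> 0)).
have m'1 : tnth m' ord_max = (fun u => (u, 1 - bump u)).
  by rewrite (tnth_nth (fun=> 0)).
(* The levels make [o] the overstrand and [w] the understrand at both crossings. *)
pose o : 'I_2 := if (lev ord0 < lev ord_max)%N then ord_max else ord0.
pose w : 'I_2 := if (lev ord0 < lev ord_max)%N then ord0 else ord_max.
have levE (i j : 'I_2) : i != j -> (lev j < lev i)%N -> i = o /\ j = w.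
  rewrite /o /w.
  case: (I2P i) => ->; case: (I2P j) => -> //= _; last by move=> ->.
  by rewrite ltnNge => /negbTE; rewrite leq_eqVlt => /norP[_ /negbTE ->].
have low : (lev w < lev o)%N.
  rewrite /o /w; case: (ltnP (lev ord0)) => //.
  by rewrite leq_eqVlt => /orP[/eqP/(strands_lev S)/eqP|//].
pose x (b : bool) : R := if b then 1 else -1.
have x2 b : `|x b| <= 2 by case: b.
have xlt2 b : `|x b| < 2 by case: b; rewrite /= ?normrN normr1 ltr1n.
pose pos b := (strand_at p r o (x b), strand_at p r w (x b)).
have mx b i : tnth m' i (x b) = (x b, 0).
  case: (I2P i) => ->; rewrite ?m'0 ?m'1 //.
  by case: b; rewrite /x ?bumpN bump1 subrr.
have posE b : pos b \in chords (gauss E).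
  by apply: (strand_chord S') => //; rewrite !mx.
have posI b : ~~ outside p r (pos b).1 by rewrite (inside_at S').
have same (i : 'I_2) u v : u != v -> tnth m' i u <> tnth m' i v.
  move=> uv; case: (I2P i) => ->; rewrite ?m'0 ?m'1;
  by move=> /(congr1 fst) /= /eqP; apply/negP.
have iD : inner_chords p r D [::] pos (fun b => csign (gauss E) (pos b)).
  split=> // d dD di.
  have [i [j [u [v [[u2 v2] _ mm uv _]]]]] := inner_chord S dD di.
  move: mm uv; case: (I2P i) (I2P j) => -> [] ->; rewrite ?m0 ?m1.
  + by case=> ->; rewrite eqxx.
  + by move=> [_ /eqP]; rewrite eq_sym oner_eq0.
  + by move=> [_ /eqP]; rewrite oner_eq0.
  + by case=> ->; rewrite eqxx.
have iE :
    inner_chords p r E [:: true; false] pos (fun b => csign (gauss E) (pos b)).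
  split=> [//|b b' _ _ [/(at_inj S')]||d dE di].
  - by case: b; case: b' => //= /eqP; lra.
  - by move=> b _; split.
  have [i [j [u [v [[u2 v2] d_uv mm uv lij]]]]] := inner_chord S' dE di.
  have ij : i != j.
    apply/eqP => ij; subst j; apply: (same i u v) => //.
    by apply: contra uv => /eqP ->.
  have [io jw] := levE i j ij (lij ij); rewrite d_uv io jw.
  have : v = u /\ bump u = 1.
    move: mm ij; case: (I2P i) (I2P j) => -> [] -> //; rewrite ?m'0 ?m'1.
      by move=> [-> b1] _; split=> //; lra.
    by move=> [-> b1] _; split=> //; lra.
  by move=> [-> /(bump_eq1 u2) [] ->]; [exists true|exists false].
have sgnN : csign (gauss E) (pos false) = - csign (gauss E) (pos true).
  have dm i b : is_derive (x b) 1 (tnth m' i)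
      (1, if i == ord0 then 0 else - dbump (x b)).
    case: (I2P i) => ->; rewrite ?m'0 ?m'1 /=; apply: is_derive_pair.
    have hb := is_derive_bump (x b).
    have := is_deriveB (is_derive_cst (1 : R) (x b) 1) hb.
    by rewrite sub0r; apply.
  rewrite /pos !(strand_sign S' (xlt2 _) (xlt2 _) _ (dm _ _) (dm _ _)) ?mx //.
  rewrite -[RHS]mulrN; congr (_ * _).
  (* The bump is even, so the curved strand has opposite slopes at -1 and 1. *)
  have dN : dbump (x false) = - dbump (x true) by rewrite /dbump /x; ring.
  rewrite dN /cross /= -sgzN; congr sgz; case: ifP => _; case: ifP => _; ring.
have HD := H_inner (D := D) q S uo oD (fun c _ => erefl) iD.
rewrite HD (H_inner q S' uo oE os iE) /=.
rewrite wH_parallel //=.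
- by rewrite /sum_inter /inter eqxx.
- by rewrite /sum_inter /inter eqxx.
- by rewrite /sum_inter /=; apply: inter_anti.
- move=> e /mapP[d /oo[d1 d2] ->]; rewrite /sum_inter /=.
  (* Both new chords go from the strand [o] to the strand [w]. *)
  exact: (inter_outer o w S' d1 d2).
Qed.

End Moves.

(** * The triangle of the third Reidemeister move *)

Local Notation st0 := (@Ordinal 3 0 isT).
Local Notation st1 := (@Ordinal 3 1 isT).
Local Notation st2 := (@Ordinal 3 2 isT).

Local Notation crossings := [:: 0; 1; 2]%N.

Definition tri_strands (a : nat) : 'I_3 * 'I_3 :=
  match a with 0 => (st0, st1) | 1 => (st0, st2) | _ => (st1, st2) end.

(* Both strands reach the crossing [a] at the model parameter
   [s * tri_param a], where [s] is 1 before the move and -1 after it. *)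
Definition tri_param (a : nat) : int :=
  match a with 0 => 0 | 1 => 1 | _ => -1 end.

(* The sign of the crossing [a] when its strands are oriented as in the model
   and the first one is the overstrand. *)
Definition tri_sign (a : nat) : int := match a with 0 | 1 => -1 | _ => 1 end.

Definition sgb (b : bool) : int := if b then 1 else -1.

(* A pair (i, x) stands for the point of parameter x of the strand i.  In the
   sequel [o a] tells whether the first strand of the crossing [a] is the
   overstrand, [q i] whether the strand i is oriented as in the model, and
   [b i j] whether the strand i comes before the strand j on the knotoid. *)
Definition tri_chord (o : nat -> bool) (s : int) (a : nat) :
    ('I_3 * int) * ('I_3 * int) :=
  let: (i, j) := tri_strands a in
  let x := s * tri_param a in
  if o a then ((i, x), (j, x)) else ((j, x), (i, x)).

Definition tri_lt (b : 'I_3 -> 'I_3 -> bool) (q : 'I_3 -> bool) :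
    rel ('I_3 * int) :=
  fun x y => if x.1 == y.1 then (if q x.1 then x.2 < y.2 else y.2 < x.2)
             else b x.1 y.1.

Definition tri_csign (q : 'I_3 -> bool) (o : nat -> bool) a : int :=
  let: (i, j) := tri_strands a in
  sgb (o a) * sgb (q i) * sgb (q j) * tri_sign a.

Definition tri_inter b q o s a c : int :=
  inter (tri_lt b q) (tri_chord o s a) (tri_chord o s c).

Lemma tri_inter_diag b q o s a : tri_inter b q o s a a = 0.
Proof. by rewrite /tri_inter /inter eqxx. Qed.

(* Choosing at each crossing the path from the first strand to the second one
   makes the degrees a cocycle: the degrees of 01, 12 and 20 add up to 0. *)
Definition tri_coef (a : nat) : int := match a with 1 => -1 | _ => 1 end.

(** Reversing a chord negates its row of the matrix, hence its degree; the factor [sgb (o a)]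
    compensates for this. *)
Definition tri_weight o a : int := sgb (o a) * tri_coef a.

(** The final 0 and the bracketing are those of an unfolded sum over [crossings]. *)
Definition tri_degree b q o s a : int :=
  tri_csign q o 0 * tri_inter b q o s a 0 +
  (tri_csign q o 1 * tri_inter b q o s a 1 +
  (tri_csign q o 2 * tri_inter b q o s a 2 + 0)).

Definition others (a : nat) : nat * nat :=
  match a with 0 => (1, 2) | 1 => (0, 2) | _ => (0, 1) end.

(** The quantity compared in the last hypothesis of [wterm_pair], for the two chords other than
    a. *)
Definition tri_square b q o s a : int :=
  let: (c, d) := others a in
  tri_csign q o c * tri_weight o c * tri_inter b q o s a c ^+ 2 -
  tri_csign q o d * tri_weight o d * tri_inter b q o s a d ^+ 2.

Definition ord_of (b01 b02 b12 : bool) (i j : 'I_3) : bool :=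
  match val i, val j with
  | 0, 1 => b01 | 0, 2 => b02 | 1, 2 => b12
  | 1, 0 => ~~ b01 | 2, 0 => ~~ b02 | 2, 1 => ~~ b12 | _, _ => false
  end.

Definition three (T : Type) (x0 x1 x2 : T) (a : nat) : T :=
  match a with 0 => x0 | 1 => x1 | _ => x2 end.

(** A finite verification over 512 cases. They include cyclic values of b and of o, which come from
    no linear order, and the identities hold for them as well. *)
Lemma triangle_check b01 b02 b12 q0 q1 q2 o0 o1 o2 :
  let b := ord_of b01 b02 b12 in
  let q (i : 'I_3) := three q0 q1 q2 (val i) in
  let o := three o0 o1 o2 in
  let d a := tri_degree b q o 1 a in
  [&& all (fun a => d a == tri_degree b q o (-1) a) crossings,
      tri_weight o 0 * d 0 + (tri_weight o 1 * d 1 +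
        (tri_weight o 2 * d 2 + 0)) == 0 &
      all (fun a => tri_square b q o 1 a == tri_square b q o (-1) a) crossings].
Proof.
case: b01; case: b02; case: b12; case: q0; case: q1; case: q2;
by case: o0; case: o1; case: o2; vm_compute.
Qed.

Lemma ord3P (i : 'I_3) : [\/ i = st0, i = st1 | i = st2].
Proof.
case: i => [[|[|[|//]]]] ?; [apply: Or31|apply: Or32|apply: Or33];
by apply/val_inj.
Qed.

(** * From the model strands to the combinatorial triangle *)

Section Triangle.
Variables (R : realType) (h : R * R -> R * R) (p r : 'I_3 -> R).
Variable lev : 'I_3 -> nat.
Implicit Types (D E : diagram R) (u v : R) (c e : R * R) (s : int).

Local Notation at_ := (strand_at p r).

Definition tri_b :=
  ord_of (at_ st0 0 < at_ st1 0) (at_ st0 0 < at_ st2 0)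
         (at_ st1 0 < at_ st2 0).

Definition tri_q (i : 'I_3) :=
  three (0 < r st0) (0 < r st1) (0 < r st2) (val i).

Definition tri_o :=
  three (lev st1 < lev st0)%N (lev st2 < lev st0)%N (lev st2 < lev st1)%N.

Definition tri_pt (x : 'I_3 * int) : R := at_ x.1 x.2%:~R.

Definition tri_pos s a : R * R :=
  (tri_pt (tri_chord tri_o s a).1, tri_pt (tri_chord tri_o s a).2).

Definition tri_height s (i : 'I_3) u : R :=
  match val i with 0 => u | 1 => - u | _ => s%:~R * bump u end.

Section OneSide.
Variables (E : diagram R) (k : 'I_3 -> R -> R * R) (s : int).
Hypothesis S : strands h p r lev E k.
Hypothesis s1 : s \in [:: 1; -1].
Hypothesis kE : forall i u, k i u = (u, tri_height s i u).

Lemma tri_bE i j : i != j -> tri_b i j = (at_ i 0 < at_ j 0).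
Proof.
have z2 : `|0 : R| <= 2 by rewrite normr0.
have N x y : x != y -> (at_ y 0 < at_ x 0) = ~~ (at_ x 0 < at_ y 0).
  by move=> xy; rewrite ltNge le_eqVlt (negbTE (strands_disjoint S xy z2 z2)).
by case: (ord3P i) => ->; case: (ord3P j) => -> //= _; rewrite [RHS]N.
Qed.

Lemma tri_qE i : tri_q i = (0 < r i).
Proof. by case: (ord3P i) => ->. Qed.

Definition tri_small (x : 'I_3 * int) := x.2 \in [:: -1; 0; 1].

Lemma tri_small2 x : tri_small x -> `|x.2%:~R : R| < 2.
Proof.
rewrite /tri_small !inE => /or3P[] /eqP -> /=;
by rewrite ?normrN ?normr0 ?normr1 ?ltr1n ?ltr0n.
Qed.

Lemma tri_chord_small o a :
  tri_small (tri_chord o s a).1 /\ tri_small (tri_chord o s a).2.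
Proof.
move: s1; rewrite /tri_chord !inE => /orP[] /eqP ->.
  by case: a => [|[|a]] /=; case: ifP.
by case: a => [|[|a]] /=; case: ifP.
Qed.

(** On one strand the order is that of the model parameters or its opposite, according to the sign
    of [r]; between two strands it does not depend on the points. *)
Lemma tri_pt_lt x y : tri_small x -> tri_small y ->
  (tri_pt x < tri_pt y) = tri_lt tri_b tri_q x y.
Proof.
move=> /tri_small2/ltW x2 /tri_small2/ltW y2; rewrite /tri_lt /tri_pt.
case: eqP => [<-|/eqP xy].
  rewrite tri_qE /strand_at ltrD2l.
  have := strands_r S x.1; rewrite neq_lt => /orP[r0|r0].
    by rewrite ltr_nM2l // ltr_int (lt_gtF r0).
  by rewrite ltr_pM2l // ltr_int r0.
by rewrite tri_bE //; apply: (strand_lt S); rewrite ?normr0.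
Qed.

Lemma tri_pt_inj x y :
  tri_small x -> tri_small y -> tri_pt x = tri_pt y -> x = y.
Proof.
move=> /tri_small2/ltW x2 /tri_small2/ltW y2; rewrite /tri_pt => xyE.
have [xy|xy] := eqVneq x.1 y.1; last first.
  by have := strands_disjoint S xy x2 y2; rewrite xyE eqxx.
move: xyE; rewrite xy => /(at_inj S) /intr_inj; move: xy.
by case: x y {x2 y2} => [? ?] [? ?] /= -> ->.
Qed.

Lemma tri_interE (a c : nat) :
  inter <%R (tri_pos s a) (tri_pos s c) = tri_inter tri_b tri_q tri_o s a c.
Proof.
have [a1 a2] := tri_chord_small tri_o a.
have [c1 c2] := tri_chord_small tri_o c.
apply: inter_map.
  apply/eqP/eqP => [[/(tri_pt_inj c1 a1) + /(tri_pt_inj c2 a2)]|->//].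
  by case: (tri_chord _ _ a) (tri_chord _ _ c) => [? ?] [? ?] /= -> ->.
by move=> x y; rewrite !inE => /orP[] /eqP -> /orP[] /eqP ->; apply: tri_pt_lt.
Qed.

Lemma s_sqr : s%:~R * s%:~R = 1 :> R.
Proof. by move: s1; rewrite !inE => /orP[] /eqP ->; rewrite ?mulrNN mulr1. Qed.

Lemma bump_s u : bump (s%:~R * u) = bump u.
Proof.
by move: s1; rewrite !inE => /orP[] /eqP ->; rewrite ?mul1r // mulN1r bumpN.
Qed.

Definition tri_slope (i : 'I_3) u : R :=
  match val i with 0 => 1 | 1 => - 1 | _ => s%:~R * dbump u end.

Lemma tri_derive i u : is_derive u 1 (k i) (1, tri_slope i u).
Proof.
have -> : k i = (fun u => (u, tri_height s i u)) by apply/funext => x.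
apply: is_derive_pair.
case: (ord3P i) => ->; rewrite /tri_slope /tri_height /=.
- exact: is_derive_id.
- exact: (is_deriveN (is_derive_id u (1 : R))).
- by have hb := is_derive_bump u; exact: (is_deriveZ (s%:~R : R) hb).
Qed.

Lemma tri_meet a : tri_height s (tri_strands a).1 (s * tri_param a)%:~R =
  tri_height s (tri_strands a).2 (s * tri_param a)%:~R.
Proof.
have bs : bump (s%:~R : R) = 1 by have := bump_s 1; rewrite mulr1 bump1.
case: a => [|[|a]]; rewrite /tri_height /= ?mulr0 ?mulr1 ?mulrN1 ?oppr0 //.
  by rewrite bs mulr1.
by rewrite mulrNz opprK bumpN bs mulr1.
Qed.

Lemma tri_meet_inv i j u v :
    `|u| <= 2 -> `|v| <= 2 -> i != j -> k i u = k j v ->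
  exists a, [/\ a \in crossings, u = (s * tri_param a)%:~R, v = u &
    (i, j) = tri_strands a \/ (j, i) = tri_strands a].
Proof.
move=> u2 v2 ij; rewrite !kE => -[<-] {v v2}.
wlog ltij : i j ij / (i < j)%N.
  move=> W hE; have [lt_ij|le_ji] := ltnP i j; first exact: W.
  have [||a [aK ua _ hor]] := W j i _ _ (esym hE).
  - by rewrite eq_sym.
  - by rewrite ltn_neqAle le_ji andbT; apply: contra ij => /eqP /val_inj ->.
  by exists a; split=> //; case: hor => hor; [right|left].
(* As s is a sign and [bump] is even, s w is a fixed point of [bump], hence equal to 1. *)
have su_fix (w : R) : `|w| <= 2 -> w = s%:~R * bump w -> w = s%:~R.
  move=> w2 wE; have : bump (s%:~R * w) = s%:~R * w.
    by rewrite (bump_s w) [in RHS]wE mulrA s_sqr mul1r.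
  move=> /bump_fix h1; have {}h1 : s%:~R * w = 1.
    apply: h1; move: s1; rewrite !inE => /orP[] /eqP ->;
    by rewrite ?mul1r ?mulN1r ?normrN.
  have -> : w = s%:~R * (s%:~R * w) by rewrite mulrA s_sqr mul1r.
  by rewrite h1 mulr1.
(* The three pairs of strands give the equations u = -u, u = s bump(u) and -u = s bump(u). *)
move: ltij ij; case: (ord3P i) => ->; case: (ord3P j) => -> //= _ _;
  rewrite /tri_height /= => uE.
- exists 0%N; split=> //; last by left.
  by rewrite mulr0; lra.
- exists 1%N; split=> //; last by left.
  by rewrite mulr1; apply: su_fix.
- exists 2%N; split=> //; last by left.
  by rewrite mulrN1 mulrNz -(su_fix (- u)) ?opprK ?normrN // bumpN.
Qed.

Lemma tri_sgz i : sgz (r i) = sgb (tri_q i).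
Proof.
rewrite tri_qE /sgb; have := strands_r S i; rewrite neq_lt => /orP[r0|r0].
  by rewrite ltr0_sgz // (lt_gtF r0).
by rewrite gtr0_sgz // r0.
Qed.

Lemma tri_oE a : tri_o a = (lev (tri_strands a).2 < lev (tri_strands a).1)%N.
Proof. by case: a => [|[|a]]. Qed.

Lemma tri_cross a :
  sgz (cross (1, tri_slope (tri_strands a).1 (s * tri_param a)%:~R)
             (1, tri_slope (tri_strands a).2 (s * tri_param a)%:~R)) =
  tri_sign a.
Proof.
(* The slope of the bump is odd, so s cancels and the signs are the same before and after the
   move. *)
have sd u : s%:~R * dbump (s%:~R * u) = dbump u :> R.
  by move: s1; rewrite !inE => /orP[] /eqP ->; rewrite /dbump /=; ring.
case: a => [|[|a]]; rewrite /tri_slope /cross /=.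
- by rewrite ltr0_sgz //; lra.
- by rewrite intrM sd ltr0_sgz // /dbump /=; lra.
- by rewrite intrM sd gtr0_sgz // /dbump /=; lra.
Qed.

Lemma tri_strands_neq a : (tri_strands a).1 != (tri_strands a).2.
Proof. by case: a => [|[|a]]. Qed.

Lemma tri_posE a : tri_pos s a =
  let u := (s * tri_param a)%:~R in
  if tri_o a then (at_ (tri_strands a).1 u, at_ (tri_strands a).2 u)
  else (at_ (tri_strands a).2 u, at_ (tri_strands a).1 u).
Proof.
by rewrite /tri_pos /tri_chord; case: (tri_strands a) => i j; case: ifP.
Qed.

Lemma tri_csignE a : tri_csign tri_q tri_o a =
  sgb (tri_o a) * sgb (tri_q (tri_strands a).1) * sgb (tri_q (tri_strands a).2)
    * tri_sign a.
Proof. by rewrite /tri_csign; case: (tri_strands a). Qed.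

Lemma tri_inner :
  inner_chords p r E crossings (tri_pos s) (tri_csign tri_q tri_o).
Proof.
have par2 a : `|(s * tri_param a)%:~R : R| < 2.
  have [+ _] := tri_chord_small tri_o a; rewrite /tri_chord.
  by case: (tri_strands a) => i j; case: ifP => _ /tri_small2.
split.
- by [].
- move=> a c aK cK [].
  have [a1 a2] := tri_chord_small tri_o a.
  have [c1 c2] := tri_chord_small tri_o c.
  (* Crossings are told apart by their strands alone, whatever the levels. *)
  pose strand (x : 'I_3 * int) := val x.1.
  move=> /(tri_pt_inj a1 c1)/(congr1 strand) +.
  move=> + /(tri_pt_inj a2 c2)/(congr1 strand).
  move: aK cK; rewrite /tri_chord !inE => /or3P[] /eqP -> /or3P[] /eqP -> //=;
  by case: (lev _ < lev _)%N; case: (lev _ < lev _)%N.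
- move=> a _; rewrite tri_posE tri_csignE; set u : R := (s * tri_param a)%:~R.
  lazy zeta; set i := (tri_strands a).1; set j := (tri_strands a).2.
  have u2 : `|u| < 2 := par2 a.
  have mE : k i u = k j u by rewrite !kE tri_meet.
  have cr : sgz (cross (1, tri_slope i u) (1, tri_slope j u)) = tri_sign a.
    exact: tri_cross.
  case: ifP => oa.
    split.
    + by apply: (strand_chord S); rewrite ?(ltW u2) // -tri_oE.
    + by rewrite (inside_at S) // (ltW u2).
    + rewrite (strand_sign S u2 u2 mE (tri_derive i u) (tri_derive j u)).
      by rewrite cr !tri_sgz /sgb mul1r.
  have ji : (lev i < lev j)%N.
    rewrite ltn_neqAle leqNgt -tri_oE oa andbT (inj_eq (strands_lev S)).
    exact: tri_strands_neq.
  split.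
  + by apply: (strand_chord S); rewrite ?(ltW u2).
  + by rewrite (inside_at S) // (ltW u2).
  + rewrite (strand_sign S u2 u2 (esym mE) (tri_derive j u) (tri_derive i u)).
    (* The overstrand is now the second strand, which exchanges the two tangents. *)
    have -> : cross (1, tri_slope j u) (1, tri_slope i u) =
        - cross (1, tri_slope i u) (1, tri_slope j u).
      by rewrite /cross; ring.
    by rewrite sgzN cr !tri_sgz /sgb; ring.
- move=> d dE di.
  have [i [j [u [v [[u2 v2] d_uv mm uv lij]]]]] := inner_chord S dE di.
  have ij : i != j.
    by apply: contra uv => /eqP ij; move: mm; rewrite ij !kE => -[->].
  have [a [aK ua vu hor]] := tri_meet_inv u2 v2 ij mm.
  exists a => //; rewrite d_uv vu tri_posE /=.
  have := lij ij => {}lij.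
  have := tri_oE a; case: hor => <- /= ->.
    by rewrite lij ua.
  by rewrite ltnNge (ltnW lij) ua.
Qed.

End OneSide.

End Triangle.

(** * Invariance under the third Reidemeister move *)

Section ThirdMove.
Variable R : realType.
Implicit Types (D E : diagram R) (u v : R) (c e : R * R).

Lemma tri_check (p r : 'I_3 -> R) lev
    (b := tri_b p r) (q := tri_q r) (o := tri_o lev) :
  [/\ {in crossings, tri_degree b q o 1 =1 tri_degree b q o (-1)},
      tri_weight o 0 * tri_degree b q o 1 0 +
        (tri_weight o 1 * tri_degree b q o 1 1 +
        (tri_weight o 2 * tri_degree b q o 1 2 + 0)) = 0 &
      {in crossings, tri_square b q o 1 =1 tri_square b q o (-1)}].
Proof.
have := triangle_check (strand_at p r st0 0 < strand_at p r st1 0)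
  (strand_at p r st0 0 < strand_at p r st2 0)
  (strand_at p r st1 0 < strand_at p r st2 0)
  (0 < r st0) (0 < r st1) (0 < r st2)
  (lev st1 < lev st0)%N (lev st2 < lev st0)%N (lev st2 < lev st1)%N.
move=> /and3P[/allP h1 /eqP h2 /allP h3].
by split=> [a /h1 /eqP|//|a /h3 /eqP].
Qed.

Lemma H_Omega3 D E : Omega3 D E -> H D = H E.
Proof.
move=> DE; apply/funext => n.
have bb (i : 'I_3) u (m : 3.-tuple (R -> R * R)) : `|u| <= 2 ->
    tnth m i u = (u, tri_height 1 i u) \/
    tnth m i u = (u, tri_height (-1) i u) ->
    box (tnth m i u).
  move=> u2; have /andP[b0 b1] := bump_bound u2.
  case=> ->; split=> //=; case: (ord3P i) => ->;
  rewrite /tri_height /= ?normrN //;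
  by rewrite ?mul1r ?mulN1r ?normrN ger0_norm //; lra.
have mE i u :
    tnth [tuple fun u => (u, u); fun u => (u, - u); fun u => (u, bump u)] i u =
    (u, tri_height 1 i u).
  rewrite (tnth_nth (fun=> 0)) /tri_height.
  by case: (ord3P i) => -> /=; rewrite ?mul1r.
have m'E i u :
    tnth [tuple fun u => (u, u); fun u => (u, - u); fun u => (u, - bump u)] i u
    = (u, tri_height (-1) i u).
  rewrite (tnth_nth (fun=> 0)) /tri_height.
  by case: (ord3P i) => -> /=; rewrite ?mulN1r.
have [i u u2|i u u2|h [p [r [lev [S S' DE']]]]] := local_move_strands _ _ DE.
- by apply: bb => //; left; rewrite mE.
- by apply: bb => //; right; rewrite m'E.
have [uo oD oE oo os] := outer_chordsE S S' DE'.
have s1 : 1 \in [:: 1; -1 : int] by [].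
have s1' : -1 \in [:: 1; -1 : int] by [].
have [F1 F2 F3] := tri_check p r lev.
set b := tri_b p r in F1 F2 F3.
set q := tri_q r in F1 F2 F3; set o := tri_o lev in F1 F2 F3.
have HD := H_inner (D := D) n S uo oD (fun c _ => erefl) (tri_inner S s1 mE).
rewrite HD (H_inner n S' uo oE os (tri_inner S' s1' m'E)) {HD}.
pose w (x : nat + R * R) : int :=
  match x with inl a => tri_weight o a | inr _ => 1 end.
have IE (a c : nat) :
    sum_inter (tri_pos p r lev 1) (inl a) (inl c) = tri_inter b q o 1 a c.
  exact: (tri_interE S s1).
have JE (a c : nat) :
    sum_inter (tri_pos p r lev (-1)) (inl a) (inl c) = tri_inter b q o (-1) a c.
  exact: (tri_interE S' s1').
have par2 s a : s \in [:: 1; -1] -> `|(s * tri_param a)%:~R : R| <= 2.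
  rewrite !inE => /orP[] /eqP ->; case: a => [|[|a]] /=;
  by rewrite ?normrN ?normr0 ?normr1 ?ler1n ?ler0n.
have dI a : wdeg [seq inl x | x <- crossings] (sum_sign D (tri_csign q o))
     (sum_inter (tri_pos p r lev 1)) (inl a) = tri_degree b q o 1 a.
  by rewrite /wdeg /= !big_cons big_nil !IE.
have dJ a : wdeg [seq inl x | x <- crossings] (sum_sign D (tri_csign q o))
     (sum_inter (tri_pos p r lev (-1))) (inl a) = tri_degree b q o (-1) a.
  by rewrite /wdeg /= !big_cons big_nil !JE.
apply: (wH_triangle (w := w)).
(* The ends of a triangle chord stay on their strands, so its entries with the outer chords do not
   change. *)
- move=> _ _ /mapP[d /oo[d1 d2] ->] /mapP[a _ ->].
  have [u2 u'2] := (par2 1 a s1, par2 _ a s1').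
  rewrite /sum_inter /= !tri_posE /=.
  by case: ifP => _; exact: (inter_outer _ _ S d1 d2 u2 u2 u'2 u'2).
- by move=> _ _ /mapP[d _ ->] /mapP[d' _ ->].
- by move=> _ /mapP[a aK ->]; rewrite dI dJ F1.
- move=> _ /mapP[d /oo[d1 d2] ->].
  (* With its ends slid to the parameter 0 of their strands, a triangle chord has with d an entry
     equal to a difference of values of t. The three differences cancel around the triangle. *)
  pose t (i : 'I_3) : int :=
    (d.2 < strand_at p r i 0)%R%:Z - (d.1 < strand_at p r i 0)%R%:Z.
  have tE a : w (inl a) * sum_inter (tri_pos p r lev 1) (inl a) (inr d) =
      tri_coef a * (t (tri_strands a).2 - t (tri_strands a).1).
    have z2 : `|0 : R| <= 2 by rewrite normr0.
    have ne (i j : 'I_3) :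
        (d == (strand_at p r i 0, strand_at p r j 0)) = false.
      by apply/eqP => ee; move: d1; rewrite ee (inside_at S).
    rewrite /w /tri_weight /sum_inter /= tri_posE -/o /=; case: ifP => oa /=.
      have [-> _] := inter_outer (tri_strands a).1 (tri_strands a).2 S d1 d2
        (par2 1 a s1) (par2 1 a s1) z2 z2.
      by rewrite /inter ne /side /sgb /t /=; ring.
    have [-> _] := inter_outer (tri_strands a).2 (tri_strands a).1 S d1 d2
      (par2 1 a s1) (par2 1 a s1) z2 z2.
    by rewrite /inter ne /side /sgb /t /=; ring.
  by rewrite !big_cons big_nil !tE /=; ring.
- rewrite !big_cons big_nil !dI; exact F2.
- move=> d; rewrite !big_cons big_nil addr0 addrA => dw.
  have w1 x : w x \in [:: -1; 1].
    case: x => [a|//]; rewrite /w /tri_weight /sgb.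
    by case: (o a); case: a => [|[|a]].
  have [_ _ iD _] := tri_inner S s1 mE; have [_ _ iE _] := tri_inner S' s1' m'E.
  have I3 (a c : nat) : a \in crossings -> c \in crossings ->
      sum_inter (tri_pos p r lev 1) (inl a) (inl c) \in [:: -1; 0; 1].
    move=> /iD[aC _ _] /iD[cC _ _].
    by have [] := simple_inter (gauss_simple D) aC cC.
  have J3 (a c : nat) : a \in crossings -> c \in crossings ->
      sum_inter (tri_pos p r lev (-1)) (inl a) (inl c) \in [:: -1; 0; 1].
    move=> /iE[aC _ _] /iE[cC _ _].
    by have [] := simple_inter (gauss_simple E) aC cC.
  have t0 s (x : nat + R * R) : wterm (sum_sign D (tri_csign q o))
      (sum_inter (tri_pos p r lev s)) d n x x = 0.
    by rewrite /wterm /sum_inter /inter eqxx mulr0 freegU0 if_same.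
  move: IE JE F1 F3 (tri_inter_diag b q o 1) (tri_inter_diag b q o (-1)).
  rewrite /tri_degree /tri_square.
  move: (tri_inter b q o 1) (tri_inter b q o (-1)) => IP IM IE JE F1 F3 P0 M0.
  move=> _ /mapP[a aK ->]; rewrite !big_cons !big_nil !addr0.
  (* As the diagonal entries vanish, [F1] and [F3] become the last two hypotheses of
     [wterm_pair]. *)
  have := F1 a aK; have := F3 a aK; move: (aK).
  rewrite !inE => /or3P[] /eqP -> /=;
    rewrite !P0 !M0 !t0 !mulr0 !addr0 ?add0r => sqE sumE.
  - apply: (wterm_pair n w1); rewrite ?IE ?JE //.
    by split; rewrite -?IE -?JE ?I3 ?J3.
  - apply: (wterm_pair n w1); rewrite ?IE ?JE //; first by rewrite -dw; ring.
    by split; rewrite -?IE -?JE ?I3 ?J3.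
  - apply: (wterm_pair n w1); rewrite ?IE ?JE //; first by rewrite -dw; ring.
    by split; rewrite -?IE -?JE ?I3 ?J3.
Qed.

End ThirdMove.

(** * The symmetry of H for invertible diagrams *)

Theorem corollary1p1 (R : realType) (D : diagram R) :
  invertible D -> subst_tinv (H D) = H D.
Proof.
rewrite -H_inverse => DE; apply/esym; move: DE; rewrite /invertible.
elim=> [D1 D2 DE|//|D1 D2 _ ->//|D1 D2 D3 _ -> _ ->//].
by case: DE => [/H_isotopy|/H_Omega1|/H_Omega2|/H_Omega3].
Qed.
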